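(* Let $\alpha\in(0,1]$ and let $m$ be an arbitrary non-negative integer. Suppose that ${}^{C}D_a^{k\alpha,\psi}u\in C[a,b]$ for $k=0,1,\dots,m+1$, where ${}^{C}D_a^{k\alpha,\psi}:={}^{C}D_a^{\alpha,\psi}\circ\dots\circ{}^{C}D_a^{\alpha,\psi}$ ($k$ times) denotes the $k$-th sequential fractional derivative operator. Then for every $t\in(a,b]$ there exists $\xi\in(a,t)$ such that $$u(t)=\sum_{j=0}^m\frac{{}^{C}D_a^{j\alpha,\psi}u(a)}{\Gamma(j\alpha+1)}\,(\psi(t)-\psi(a))^{j\alpha}+\frac{{}^{C}D_a^{(m+1)\alpha,\psi}u(\xi)}{\Gamma((m+1)\alpha+1)}\,(\psi(t)-\psi(a))^{(m+1)\alpha}.$$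
   Context: Let $0\le a<b<\infty$. The function $\psi$ is non-negative, continuous and increasing on $(a,b]$, of class $C^1(a,b]$, with $\psi'(t)\neq0$ for all $t\in(a,b]$; $\psi(a):=\lim_{t\to a^+}\psi(t)$. Functions $u:[a,b]\to\mathbb{R}$ are real-valued. Write $\varrho=\frac1{\psi'}\frac{d}{dt}$. For $\gamma>0$, $$I_a^{\gamma,\psi}u(t)=\frac1{\Gamma(\gamma)}\int_a^t\frac{\psi'(s)u(s)}{(\psi(t)-\psi(s))^{1-\gamma}}\,ds,\qquad I_a^{0,\psi}u=u.$$ For $\alpha\in(0,1]$, ${}^{RL}D_a^{\alpha,\psi}u=\varrho\, I_a^{1-\alpha,\psi}u$ and ${}^{C}D_a^{\alpha,\psi}u={}^{RL}D_a^{\alpha,\psi}(u-u(a))$. The $0$-th sequential derivative is $u$ itself. Here $k\alpha$ in ${}^{C}D_a^{k\alpha,\psi}$ always refers to the sequential (iterated) derivative; values at $a$ are those of the continuous extension. *)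

(* Defs.v *)
From HB Require Import structures.
From mathcomp Require Import all_boot all_order all_algebra.
From mathcomp Require Import all_classical all_reals all_analysis.
Set Implicit Arguments.
Unset Strict Implicit.
Unset Printing Implicit Defensive.
Import Order.TTheory GRing.Theory Num.Theory.
Import numFieldNormedType.Exports.
Local Open Scope classical_set_scope.
Local Open Scope ring_scope.

(* Euler's integral; only meaningful for 0 < x. *)
Definition Gamma (R : realType) (x : R) : R :=
  \int[lebesgue_measure]_(s in `]0, +oo[) (s `^ (x - 1) * expR (- s)).

(* Derivatives relative to the half-open interval ]a, b]: two-sided at interior
   points, left-sided at b.  Functions on [a, b] or ]a, b] are represented by
   total functions R -> R whose values elsewhere must play no role, so the
   two-sided derivative of the library cannot be used at b. *)
Definition diff_quot_oc (R : realType) (a b : R) (f : R -> R) (t : R) :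
    set_system R :=
  (f y - f t) / (y - t) @[y --> within `]a, b] t^'].

Definition derivable_oc (R : realType) (a b : R) (f : R -> R) (t : R) : Prop :=
  cvg (diff_quot_oc a b f t).

Definition derive_oc (R : realType) (a b : R) (f : R -> R) (t : R) : R :=
  lim (diff_quot_oc a b f t).

(* "increasing" is nondecreasing; strictness follows from psi' != 0.
   The last clause is the convention that psi a is the right limit at a. *)
Record kernel_function (R : realType) (a b : R) (psi : R -> R) : Prop := {
  kernel_ge0 : forall t, t \in `]a, b] -> 0 <= psi t;
  kernel_continuous : {within `]a, b], continuous psi};
  kernel_nondecreasing : {in `]a, b] &, {homo psi : s t / s <= t}};
  kernel_derivable : forall t, t \in `]a, b] -> derivable_oc a b psi t;
  kernel_derive_continuous : {within `]a, b], continuous (derive_oc a b psi)};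
  kernel_derive_neq0 : forall t, t \in `]a, b] -> derive_oc a b psi t != 0;
  kernel_at_a : psi x @[x --> a^'+] --> psi a }.

Definition rho (R : realType) (a b : R) (psi f : R -> R) (t : R) : R :=
  (derive_oc a b psi t)^-1 * derive_oc a b f t.

(* Lebesgue integral over the open interval: psi' need not exist at a, and the
   integrand may be singular at t.  For u continuous on [a, b] the integrand is
   Lebesgue integrable for every g > 0 and t in ]a, b]. *)
Definition frac_int (R : realType) (a b : R) (psi : R -> R) (g : R)
    (u : R -> R) (t : R) : R :=
  if g == 0 then u t
  else (Gamma g)^-1 *
    \int[lebesgue_measure]_(s in `]a, t[)
      (derive_oc a b psi s * u s / (psi t - psi s) `^ (1 - g)).

Definition RL_deriv (R : realType) (a b : R) (psi : R -> R) (alpha : R)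
    (u : R -> R) : R -> R :=
  rho a b psi (frac_int a b psi (1 - alpha) u).

(* The value at a is the continuous extension, i.e. the right limit. *)
Definition caputo (R : realType) (a b : R) (psi : R -> R) (alpha : R)
    (u : R -> R) (t : R) : R :=
  let D := RL_deriv a b psi alpha (fun s => u s - u a) in
  if t == a then lim (D x @[x --> a^'+]) else D t.

Definition caputo_exists (R : realType) (a b : R) (psi : R -> R) (alpha : R)
    (u : R -> R) : Prop :=
  forall t, t \in `]a, b] ->
    derivable_oc a b (frac_int a b psi (1 - alpha) (fun s => u s - u a)) t.

Definition caputo_seq (R : realType) (a b : R) (psi : R -> R) (alpha : R)
    (k : nat) (u : R -> R) : R -> R :=
  iter k (caputo a b psi alpha) u.

(* The sequential derivatives of orders 0, ..., n are defined and belong to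
   C[a, b].  Continuity at a contains the existence of the limit in [caputo];
   the derivatives on ]a, b] have to be required separately, since [derive_oc]
   is total. *)
Definition caputo_seq_continuous (R : realType) (a b : R) (psi : R -> R)
    (alpha : R) (n : nat) (u : R -> R) : Prop :=
  (forall k, (k < n)%N ->
     caputo_exists a b psi alpha (caputo_seq a b psi alpha k u)) /\
  (forall k, (k <= n)%N ->
     {within `[a, b], continuous (caputo_seq a b psi alpha k u)}).

(* Main.v *)
Require Import Defs.
From HB Require Import structures.
From mathcomp Require Import all_boot all_order all_algebra.
From mathcomp Require Import all_classical all_reals all_analysis.
From mathcomp Require Import measurable_realfun.
From mathcomp Require Import ring lra.
Set Implicit Arguments.
Unset Strict Implicit.
Unset Printing Implicit Defensive.
Import Order.TTheory GRing.Theory Num.Theory.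
Import numFieldNormedType.Exports.
Local Open Scope classical_set_scope.
Local Open Scope ring_scope.

(* Write I^g for the fractional integral of order g with respect to psi.
   Tonelli's theorem and the Beta integral give I^al I^be = I^(al+be).  If w is
   the Caputo derivative of v, then I^(1-al) (v - v a) has derivative psi' w and
   vanishes at a, so it equals I^1 w; applying I^al yields
   I^1 (v - v a) = I^1 (I^al w), and since both integrands are continuous
   (I^al w is Hoelder continuous), v = v a + I^al w.  Iterating this identity
   produces the Taylor polynomial with remainder I^((m+1) al) of the last
   derivative, to which the mean value theorem for integrals with the positive
   weight psi'(s) (psi t - psi s)^((m+1) al - 1) applies. *)

(** * Change of variables on open intervals, and translation invariance *)

Section substitution.
Context {R : realType}.
Notation mu := (@lebesgue_measure R).

(** Nothing is assumed of [psi'] near [a]: it may blow up or tend to 0 there, so no estimate can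
    rest on a bound for it. The kernel is therefore integrated exactly, which expresses every
    estimate through differences of [psi]; the fundamental theorem of calculus is used only on
    intervals [[c, t]] with [a < c], followed by [c -> a]. Raising the equation for [v - v a] to
    order 1 replaces the inversion of an Abel equation by a uniqueness statement for [I^1]. That
    statement is pointwise, whence the need for continuity of [I^al w] and not just integrability.
    Continuity is obtained for orders at most 1 only, since the kernel then decreases in its upper
    endpoint. This is enough: whenever two integrals are composed, the inner order is [al], [1 - al]
    or 1, while the outer order [n al] is unrestricted. Order 0 is the identity by convention and
    not an integral, so [al = 1] and the start of the iteration are separate cases. *)

Lemma is_derive1_near (F f : R -> R) (r t x : R) :
  {in `]r, t[, forall x : R, is_derive x 1 F (f x)} ->
  x \in `]r, t[ -> \forall y \near x, derive1 F y = f y.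
Proof.
move=> dF xrt; near=> y; have yrt : y \in `]r, t[ by near: y; apply: near_in_itvoo.
by have := dF y yrt => dFy; rewrite derive1E derive_val.
Unshelve. all: by end_near. Qed.

Lemma cvg_within_filter (T : Type) (F : set_system T) (FF : Filter F)
    (f : T -> R) (D : set R) (x : R) :
  f @ F --> x -> (\forall z \near F, D (f z)) -> f @ F --> within D (nbhs x).
Proof.
move=> fx FD A; rewrite /within/= => /fx fA.
by rewrite nbhs_filterE; near=> z; apply: (near fA z) => //; near: z.
Unshelve. all: by end_near. Qed.

(** The offset [(t - r) / n.+3] stays below half the length, which keeps the endpoints of each
    compact interval in order. Convergence of [F] at [r] and [t] makes the images exhaust the open
    interval; [F := id] gives the exhaustion of the source. *)
Lemma shrink_seq_bigcup (F : R -> R) (r t : R) : r < t ->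
  {in `[r, t] &, {homo F : x y / x < y}} ->
  F x @[x --> r^'+] --> F r -> F x @[x --> t^'-] --> F t ->
  `]F r, F t[%classic =
  \bigcup_n `[F (r + (t - r) / n.+3%:R), F (t - (t - r) / n.+3%:R)]%classic.
Proof.
move=> rt incF Fr Ft.
have tr0 : 0 < t - r by rewrite subr_gt0.
have e_gt0 n : 0 < (t - r) / n.+3%:R by rewrite divr_gt0.
have e_lt n : (t - r) / n.+3%:R < t - r.
  by rewrite ltr_pdivrMr// ltr_pMr// ltr1n.
have cvge : (t - r) / n.+3%:R @[n --> \oo] --> (0 : R).
  rewrite -[X in _ --> X](mulr0 (t - r)); apply: cvgMr.
  have := @cvg_harmonic R; rewrite -(cvg_shiftn 2); apply: cvg_trans.
  by apply: near_eq_cvg; near=> n; rewrite /harmonic /= addn2.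
have xE n : r + (t - r) / n.+3%:R \in `]r, t[.
  by have := e_gt0 n; have := e_lt n; rewrite in_itv/=; set e := _ / _; lra.
have yE n : t - (t - r) / n.+3%:R \in `]r, t[.
  by have := e_gt0 n; have := e_lt n; rewrite in_itv/=; set e := _ / _; lra.
have xcvg : r + (t - r) / n.+3%:R @[n --> \oo] --> r^'+.
  apply: cvg_within_filter; last by near=> n; rewrite /= ltrDl.
  by rewrite -[X in _ --> X]addr0; apply: cvgD => //; exact: cvg_cst.
have ycvg : t - (t - r) / n.+3%:R @[n --> \oo] --> t^'-.
  apply: cvg_within_filter; last by near=> n; rewrite /= gtrDl oppr_lt0.
  by rewrite -[X in _ --> X]subr0; apply: cvgB => //; exact: cvg_cst.
apply/seteqP; split=> z /=.
  rewrite in_itv/= => /andP[zr zt].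
  have H1 : \forall n \near \oo, F (r + (t - r) / n.+3%:R) <= z.
    have := cvg_comp _ _ xcvg Fr => /cvgr_le; apply; exact: zr.
  have H2 : \forall n \near \oo, z <= F (t - (t - r) / n.+3%:R).
    have := cvg_comp _ _ ycvg Ft => /cvgr_ge; apply; exact: zt.
  have [n [h1 h2]] := filter_ex (filterI H1 H2).
  by exists n => //=; rewrite in_itv/= h1 h2.
move=> [n _] /=; rewrite !in_itv/= => /andP[h1 h2]; apply/andP; split.
  apply: lt_le_trans h1; apply: incF; rewrite ?in_itv/= ?lexx ?(ltW rt)//.
    by have := xE n; rewrite in_itv/= => /andP[/ltW -> /ltW ->].
  by rewrite ltrDl.
apply: (le_lt_trans h2); apply: incF; rewrite ?in_itv/= ?lexx ?(ltW rt)//.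
  by have := yE n; rewrite in_itv/= => /andP[/ltW -> /ltW ->].
by rewrite gtrDl oppr_lt0.
Unshelve. all: by end_near. Qed.

(* The library's change of variables asks for one-sided limits of [F'] and
   continuity of [G] at the endpoints; here both may be singular there, so the
   interval is exhausted by compact ones. *)
Lemma ge0_integration_by_substitution_oo (F f G : R -> R) (r t : R) : r < t ->
  {in `[r, t] &, {homo F : x y / x < y}} ->
  {in `]r, t[, forall x : R, is_derive x 1 F (f x)} ->
  {in `]r, t[, continuous f} ->
  F x @[x --> r^'+] --> F r -> F x @[x --> t^'-] --> F t ->
  {in `]F r, F t[, continuous G} -> {in `]F r, F t[, forall x, 0 <= G x} ->
  {in `]r, t[, forall x, 0 <= f x} ->
  (\int[mu]_(x in `]F r, F t[) (G x)%:E =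
   \int[mu]_(x in `]r, t[) (G (F x) * f x)%:E)%E.
Proof.
move=> rt incF dF cf Fr Ft cG G0 f0.
pose x_ n : R := r + (t - r) / n.+3%:R.
pose y_ n : R := t - (t - r) / n.+3%:R.
have tr0 : 0 < t - r by rewrite subr_gt0.
have e_gt0 n : 0 < (t - r) / n.+3%:R by rewrite divr_gt0.
have e_lt n : (t - r) / n.+3%:R < (t - r) / 2.
  by rewrite ltr_pM2l// ltf_pV2 ?posrE// ltr_nat.
have e_le m n : (m <= n)%N -> (t - r) / n.+3%:R <= (t - r) / m.+3%:R.
  by move=> mn; rewrite ler_pM2l// lef_pV2 ?posrE// ler_nat.
have x_in n : x_ n \in `]r, t[.
  by have := e_gt0 n; have := e_lt n; rewrite in_itv/= /x_; set e := _ / n.+3%:R; lra.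
have y_in n : y_ n \in `]r, t[.
  by have := e_gt0 n; have := e_lt n; rewrite in_itv/= /y_; set e := _ / n.+3%:R; lra.
have xy n : x_ n < y_ n.
  by have := e_gt0 n; have := e_lt n; rewrite /x_ /y_; set e := _ / n.+3%:R; lra.
have oo_cc x : x \in `]r, t[ -> x \in `[r, t] by apply: subset_itvW.
have xyE n x : x \in `[x_ n, y_ n] -> x \in `]r, t[.
  move: (x_in n) (y_in n); rewrite !in_itv/= => /andP[? ?] /andP[? ?] /andP[? ?].
  by apply/andP; split; [exact: (@lt_le_trans _ _ (x_ n))|exact: (@le_lt_trans _ _ (y_ n))].
have incF_le : {in `[r, t] &, {homo F : x y / x <= y}}.
  move=> x y xr yr; rewrite le_eqVlt => /predU1P[->//|xy0].
  by apply: ltW; apply: incF.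
have F_in x : x \in `]r, t[ -> F x \in `]F r, F t[.
  move=> xrt; move: (xrt); rewrite !in_itv/= => /andP[rx xt].
  have rr : r \in `[r, t] by rewrite in_itv/= lexx ltW.
  have tt : t \in `[r, t] by rewrite in_itv/= lexx andbT ltW.
  by apply/andP; split; apply: incF => //; exact: oo_cc.
have cF : {in `]r, t[, continuous F}.
  move=> x /dF dFx; apply: differentiable_continuous.
  by apply/derivable1_diffP.
have eqn n : (\int[mu]_(x in `[F (x_ n), F (y_ n)]) (G x)%:E =
   \int[mu]_(x in `[x_ n, y_ n]) (G (F x) * f x)%:E)%E.
  rewrite (@integration_by_substitution_increasing R F G)//.
  - apply: eq_integral => x /[!inE]/= xxy.
    have := dF x (xyE _ _ xxy) => dFx.
    by rewrite !fctE derive1E derive_val.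
  - exact: ltW.
  - by move=> u v uxy vxy; apply: incF; apply/oo_cc/(xyE n).
  - move=> z zxy.
    have zrt := xyE n z (subset_itv_oo_cc zxy).
    have E := is_derive1_near dF zrt.
    rewrite /continuous_at (nbhs_singleton E); apply: cvg_trans (cf _ zrt).
    by apply: near_eq_cvg; apply: filterS E => y ->.
  - apply/cvg_ex; exists (f (x_ n)); apply: cvg_at_right_filter.
    have E := is_derive1_near dF (x_in n).
    apply: cvg_trans (cf _ (x_in n)).
    by apply: near_eq_cvg; apply: filterS E => y ->.
  - apply/cvg_ex; exists (f (y_ n)); apply: cvg_at_left_filter.
    have E := is_derive1_near dF (y_in n).
    apply: cvg_trans (cf _ (y_in n)).
    by apply: near_eq_cvg; apply: filterS E => y ->.
  - split.
    + move=> z zxy; apply: ex_derive; apply: dF; apply: (xyE n).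
      exact: subset_itv_oo_cc.
    + by apply: cvg_at_right_filter; exact: cF.
    + by apply: cvg_at_left_filter; exact: cF.
  - apply: continuous_in_subspaceT => z; rewrite inE/= => zF; apply: cG.
    move: zF; rewrite !in_itv/= => /andP[h1 h2]; apply/andP; split.
      by apply: lt_le_trans h1; have /F_in := x_in n; rewrite in_itv/= => /andP[].
    by apply: (le_lt_trans h2); have /F_in := y_in n; rewrite in_itv/= => /andP[].
have mGF : measurable_fun `]r, t[ (fun x => G (F x) * f x).
  apply: open_continuous_measurable_fun => //.
  move=> x; rewrite inE/= => xrt; apply: cvgM; last exact: cf.
  by apply: continuous_comp; [exact: cF|apply/cG/F_in].
have mG : measurable_fun `]F r, F t[ G.
  apply: open_continuous_measurable_fun => //.
  by move=> x; rewrite inE/=; exact: cG.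
have E1 := shrink_seq_bigcup rt incF Fr Ft.
have E2 : `]r, t[%classic = \bigcup_n `[x_ n, y_ n]%classic.
  by apply: (@shrink_seq_bigcup id) => //;
    [apply: cvg_at_right_filter|apply: cvg_at_left_filter]; exact: cvg_id.
have mono n m : (n <= m)%N -> `[x_ n, y_ n] `<=` `[x_ m, y_ m].
  move=> nm; apply: subset_itv; rewrite bnd_simp /x_ /y_.
    by rewrite lerD2l e_le.
  by rewrite lerD2l lerN2 e_le.
(* Nonnegativity allows monotone convergence along the exhaustion on both sides, whether or not the
   integrals are finite. *)
have cvgG : (\int[mu]_(x in `[F (x_ n), F (y_ n)]) (G x)%:E @[n --> \oo] -->
    \int[mu]_(x in \bigcup_n `[F (x_ n), F (y_ n)]%classic) (G x)%:E)%E.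
  apply: ge0_nondecreasing_set_cvg_integral => //.
  - move=> n m nm; rewrite subsetEset; apply: subset_itv;
      rewrite bnd_simp; apply: incF_le; rewrite ?oo_cc// /x_ /y_.
      by rewrite lerD2l e_le.
    by rewrite lerD2l lerN2 e_le.
  - move=> n; apply/measurable_EFinP; apply: measurable_funS mG => //.
    by rewrite E1; exact: (@classical_sets.bigcup_sup _ _ n).
  - move=> n x /= xn; rewrite lee_fin; apply: G0.
    by have : `]F r, F t[%classic x by rewrite E1; exists n.
have cvgGF : (\int[mu]_(x in `[x_ n, y_ n]) (G (F x) * f x)%:E @[n --> \oo] -->
    \int[mu]_(x in \bigcup_n `[x_ n, y_ n]%classic) (G (F x) * f x)%:E)%E.
  apply: ge0_nondecreasing_set_cvg_integral => //.
  - by move=> n m nm; rewrite subsetEset; exact: mono.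
  - move=> n; apply/measurable_EFinP; apply: measurable_funS mGF => //.
    by rewrite E2; exact: (@classical_sets.bigcup_sup _ _ n).
  - move=> n x /= xn; rewrite lee_fin mulr_ge0//; first by apply/G0/F_in/(xyE n).
    by apply/f0/(xyE n).
rewrite E1 E2 -/x_ -/y_; apply: (cvg_unique _ cvgG) => /=.
  exact: ereal_hausdorff.
by apply: cvg_trans cvgGF; apply: near_eq_cvg; near=> n; rewrite eqn.
Unshelve. all: by end_near. Qed.

(** The pushforward of Lebesgue measure under a translation has the right values on half-open
    intervals, and uniqueness does the rest. *)
Lemma ge0_integral_shift (f : R -> \bar R) (c : R) :
  measurable_fun setT f -> (forall x, 0 <= f x)%E ->
  (\int[mu]_x f (x - c)%R = \int[mu]_x f x)%E.
Proof.
move=> mf f0.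
pose phi : R -> measurableTypeR R := fun x => x - c.
have mphi : measurable_fun setT phi by apply: measurable_funB.
transitivity (\int[pushforward mu phi]_x f x)%E; last first.
  apply: eq_measure_integral => A mA _; apply/esym/lebesgue_measure_unique => //=.
  move=> _ [[u v]] _ <-; rewrite /pushforward/=.
  rewrite (_ : _ @^-1` _ = `]u + c, v + c]%classic); last first.
    by apply/seteqP; split=> x /=; rewrite !in_itv/= /phi; lra.
  rewrite !lebesgue_measure_itv/= !lte_fin ltrD2r.
  by case: ifP => // _; rewrite -!EFinD; congr EFin; ring.
by rewrite ge0_integral_pushforward.
Qed.

End substitution.

(** * Gamma and Beta integrals *)

Section gamma_beta.
Context {R : realType}.
Notation mu := (@lebesgue_measure R).

Lemma continuous_powR_gt0 (c x : R) : 0 < x -> {for x, continuous (@powR R ^~ c)}.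
Proof.
move=> x0; apply: differentiable_continuous; apply/derivable1_diffP.
by apply: derivable_powR; rewrite in_itv/= x0.
Qed.

Lemma measurable_fun_powR d (T : measurableType d) (D : set T) (f : T -> R) (c : R) :
  measurable D -> measurable_fun D f -> measurable_fun D (fun x => f x `^ c).
Proof.
move=> mD mf; apply: (@measurableT_comp _ _ _ _ _ _ (@powR R ^~ c)) => //.
Qed.

(** The substitution by the [g]-th power makes the integrand constant, so the singularity at 0 for
    [g < 1] disappears and only the length of an interval remains. *)
Lemma integral_powR (g x : R) : 0 < g -> 0 < x ->
  (\int[mu]_(s in `]0%R, x[) (s `^ (g - 1))%:E = (x `^ g / g)%:E)%E.
Proof.
move=> g0 x0.
have xg0 : 0 < x `^ g by rewrite powR_gt0.
have H : (\int[mu]_(s in `]0%R, (x `^ g)%R[) (cst 1 s)%:E =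
   g%:E * \int[mu]_(s in `]0%R, x[) (s `^ (g - 1))%:E)%E.
  have := @ge0_integration_by_substitution_oo R (@powR R ^~ g)
    (fun s => g * s `^ (g - 1)) (cst 1) 0 x x0.
  rewrite powR0 ?gt_eqF// => -> //=.
  - rewrite -ge0_integralZl//.
    + by apply: eq_integral => s _; rewrite mul1r.
    + by apply/measurable_EFinP; apply: measurable_fun_powR.
    + by move=> s _; rewrite lee_fin powR_ge0.
    + by rewrite lee_fin ltW.
  - move=> y z; rewrite !in_itv/= => /andP[y0 _] /andP[z0 _] yz.
    by apply: gt0_ltr_powR.
  - by move=> s; rewrite in_itv/= => /andP[s0 _]; exact: is_derive1_powR.
  - move=> s; rewrite in_itv/= => /andP[s0 _]; apply: cvgMr.
    exact: continuous_powR_gt0.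
  - exact: powR_cvg0.
  - by apply: cvg_at_left_filter; exact: continuous_powR_gt0.
  - by move=> s _; exact: cst_continuous.
  - by move=> s _; rewrite mulr_ge0 ?powR_ge0// ltW.
have gI : (g%:E * \int[mu]_(s in `]0%R, x[) (s `^ (g - 1))%:E = (x `^ g)%:E)%E.
  rewrite -H; transitivity (1%:E * mu `]0%R, (x `^ g)%R[)%E.
    by under eq_integral do rewrite /=; rewrite integral_cst.
  by rewrite lebesgue_measure_itv/= lte_fin xg0 -EFinD subr0 mul1e.
by rewrite mulrC EFinM -gI muleA -EFinM mulVf ?gt_eqF// mul1e.
Qed.

(** Extension by 0 to the whole line lets a convolution be integrated over the plane without
    tracking its domain. *)
Definition gamma_density (al x : R) : R :=
  if 0 < x then x `^ (al - 1) * expR (- x) else 0.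

(** Extended real values allow the Gamma-Beta identity to be proved by Tonelli before any finiteness
    is known; finiteness is then deduced from it. *)
Definition egamma (al : R) : \bar R :=
  (\int[mu]_(s in `]0%R, +oo[) (s `^ (al - 1) * expR (- s))%:E)%E.

Definition ebeta (al be : R) : \bar R :=
  (\int[mu]_(y in `]0%R, 1%R[) ((1 - y) `^ (al - 1) * y `^ (be - 1))%:E)%E.

Lemma gamma_density_ge0 (al x : R) : 0 <= gamma_density al x.
Proof.
by rewrite /gamma_density; case: ifP => // _; rewrite mulr_ge0 ?powR_ge0 ?expR_ge0.
Qed.

Lemma measurable_gamma_density (al : R) : measurable_fun setT (gamma_density al).
Proof.
apply: measurable_fun_ifT => //.
  by apply: measurable_fun_ltr => //; exact: measurable_cst.
apply: measurable_funM; first exact: measurable_powR.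
by apply: measurableT_comp => //; exact: measurable_expR.
Qed.

Lemma egammaE (al : R) : egamma al = (\int[mu]_x (gamma_density al x)%:E)%E.
Proof.
rewrite /egamma integral_mkcond; apply: eq_integral => x _.
rewrite patchE /gamma_density; case: ifPn.
  by rewrite inE/= in_itv/= andbT => ->.
by rewrite notin_setE/= in_itv/= andbT; case: ifP.
Qed.

Lemma Gamma_fine (al : R) : Gamma al = fine (egamma al).
Proof. by []. Qed.

Lemma ge0_integral_beta (al be l h : R) : l < h ->
  (\int[mu]_(x in `]l, h[) ((h - x) `^ (al - 1) * (x - l) `^ (be - 1))%:E =
   ((h - l) `^ (al + be - 1))%:E * ebeta al be)%E.
Proof.
move=> lh; have hl0 : 0 < h - l by rewrite subr_gt0.
pose F (y : R) := l + (h - l) * y.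
have F0 : F 0 = l by rewrite /F; ring.
have F1 : F 1 = h by rewrite /F; ring.
have dF (x : R) : is_derive x 1 F (h - l).
  have -> : F = cst l + (h - l) *: (@id R) by apply/funext.
  apply: (is_derive_eq (is_deriveD (is_derive_cst l x 1)
    (is_deriveZ (h - l) (is_derive_id x 1)))).
  by rewrite add0r /GRing.scale/= mulr1.
have cF : continuous F.
  by move=> x; apply: differentiable_continuous; apply/derivable1_diffP.
have := @ge0_integration_by_substitution_oo R F (cst (h - l))
  (fun x => (h - x) `^ (al - 1) * (x - l) `^ (be - 1)) 0 1 ltr01.
rewrite F0 F1 => -> //.
- rewrite /ebeta -ge0_integralZl//.
  + apply: eq_integral => y; rewrite inE/= in_itv/= => /andP[y0 y1].
    rewrite -EFinM; congr EFin.
    have -> : h - F y = (h - l) * (1 - y) by rewrite /F; ring.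
    have -> : F y - l = (h - l) * y by rewrite /F; ring.
    rewrite !powRM ?subr_ge0 ?ltW//.
    (* The last summand 1 accounts for the Jacobian [h - l] of the affine substitution. *)
    have -> : al + be - 1 = (al - 1) + (be - 1) + 1 by ring.
    move: (al - 1) (be - 1) => A B.
    have hl_neq0 : h - l != 0 by rewrite gt_eqF.
    by rewrite !powRD ?hl_neq0 ?implybT// powRr1 ?ltW//; ring.
  + apply/measurable_EFinP; apply: measurable_funM;
      by apply: measurable_fun_powR => //; apply: measurable_funB.
  + by move=> y _; rewrite lee_fin mulr_ge0// powR_ge0.
  + by rewrite lee_fin powR_ge0.
- by move=> x y _ _ xy; rewrite /F ltrD2l ltr_pM2l.
- by move=> x _; exact: cst_continuous.
- by apply: cvg_at_right_filter; rewrite -F0; exact: cF.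
- by apply: cvg_at_left_filter; rewrite -F1; exact: cF.
- move=> x; rewrite in_itv/= => /andP[lx xh]; apply: cvgM.
    apply: (@continuous_comp _ _ _ (fun x => h - x) (@powR R ^~ _)).
      by apply: cvgB; [exact: cvg_cst|exact: cvg_id].
    by apply: continuous_powR_gt0; rewrite subr_gt0.
  apply: (@continuous_comp _ _ _ (fun x => x - l) (@powR R ^~ _)).
    by apply: cvgB; [exact: cvg_id|exact: cvg_cst].
  by apply: continuous_powR_gt0; rewrite subr_gt0.
- by move=> x _; rewrite mulr_ge0// powR_ge0.
- by move=> x _; exact: ltW.
Qed.

(* Both sides are the integral over the plane of the convolution of two gamma
   densities. *)
Lemma egammaM (al be : R) :
  (egamma al * egamma be = ebeta al be * egamma (al + be))%E.
Proof.
pose f (z : R * R) := (gamma_density be z.1 * gamma_density al (z.2 - z.1))%:E.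
have f0 z : (0 <= f z)%E by rewrite lee_fin mulr_ge0// gamma_density_ge0.
have mf : measurable_fun setT f.
  apply/measurable_EFinP; apply: measurable_funM.
    by apply: measurableT_comp => //; exact: measurable_gamma_density.
  apply: measurableT_comp => //; first exact: measurable_gamma_density.
  by apply: measurable_funB.
have := @fubini_tonelli _ _ _ _ R mu mu f mf f0.
have -> : (\int[mu]_s \int[mu]_x f (s, x) = egamma al * egamma be)%E.
  rewrite [egamma be]egammaE -ge0_integralZl//; last 3 first.
  - by apply/measurable_EFinP; exact: measurable_gamma_density.
  - by move=> x _; rewrite lee_fin gamma_density_ge0.
  - by rewrite egammaE; apply: integral_ge0 => x _; rewrite lee_fin gamma_density_ge0.
  apply: eq_integral => s _.
  (* For fixed [s], translation invariance removes the shift and the double integral factors. *)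
  rewrite muleC egammaE -(@ge0_integral_shift _ (fun x => (gamma_density al x)%:E) s).
  - rewrite -ge0_integralZl//.
    + apply/measurable_EFinP; apply: measurableT_comp => //.
        exact: measurable_gamma_density.
      by apply: measurable_funB.
    + by move=> x _; rewrite lee_fin gamma_density_ge0.
    + by rewrite lee_fin gamma_density_ge0.
  - by apply/measurable_EFinP; exact: measurable_gamma_density.
  - by move=> x; rewrite lee_fin gamma_density_ge0.
(* In the other order, the exponentials multiply to [expR (- x)], constant in [s], and the powers
   leave a Beta integral over []0, x[]. *)
move=> ->; rewrite egammaE -ge0_integralZl//; last 3 first.
- by apply/measurable_EFinP; exact: measurable_gamma_density.
- by move=> x _; rewrite lee_fin gamma_density_ge0.
- by apply: integral_ge0 => y _; rewrite lee_fin mulr_ge0// powR_ge0.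
apply: eq_integral => x _; rewrite /f/=.
have [x0|x0] := ltP 0 x; last first.
  rewrite [gamma_density _ x]/gamma_density ltNge x0/= mule0.
  apply: integral0_eq => s _; rewrite /gamma_density.
  case: ifPn => s0; last by rewrite mul0r.
  by rewrite ifF ?mulr0//; apply/negbTE; rewrite -leNgt subr_le0 (le_trans x0)// ltW.
rewrite [gamma_density _ x]/gamma_density x0 EFinM.
have := ge0_integral_beta al be x0; rewrite subr0 => betaE.
rewrite muleA [(ebeta al be * _)%E]muleC -betaE muleC -ge0_integralZl//; last 2 first.
- apply/measurable_EFinP; apply: measurable_funM;
    by apply: measurable_fun_powR => //; apply: measurable_funB.
- by move=> s _; rewrite lee_fin mulr_ge0// powR_ge0.
rewrite [RHS]integral_mkcond; apply: eq_integral => s _; rewrite patchE.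
case: ifPn.
  rewrite inE/= in_itv/= => /andP[s0 sx].
  rewrite /gamma_density s0 subr_gt0 sx subr0 -EFinM; congr EFin.
  have -> : expR (- x) = expR (- s) * expR (- (x - s)) by rewrite -expRD; congr expR; ring.
  ring.
rewrite notin_setE/= in_itv/= /gamma_density.
case: ifPn => s0; last by rewrite mul0r.
by rewrite subr_gt0; case: ifPn => // _; rewrite mulr0.
Qed.

End gamma_beta.

(** * Positivity, functional equation and finiteness of Gamma *)

Section gamma_values.
Context {R : realType}.
Notation mu := (@lebesgue_measure R).

(** A vanishing integral would force [f] to be 0 almost everywhere and thus put an interval of
    positive length inside a null set. *)
Lemma integral_itv_gt0 (l h : R) (f : R -> R) : l < h ->
  measurable_fun `]l, h[ f -> {in `]l, h[, forall x, 0 < f x} ->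
  (0 < \int[mu]_(x in `]l, h[) (f x)%:E)%E.
Proof.
move=> lh mf f0; rewrite lt0e; apply/andP; split; last first.
  by apply: integral_ge0 => x xlh; rewrite lee_fin ltW// f0.
apply/eqP => If0.
have /ae_eq_integral_abs : (\int[mu]_(x in `]l, h[) `|(f x)%:E| = 0)%E.
  rewrite -[RHS]If0; apply: eq_integral => x; rewrite inE/= => xlh.
  by rewrite ger0_norm// ltW// f0.
have mf' : measurable_fun `]l, h[ (EFin \o f) by exact/measurable_EFinP.
move=> /(_ (measurable_itv _) mf')[N [mN N0 fN]].
have : (mu `]l, h[ <= mu N)%E.
  apply: le_measure; rewrite ?inE//; apply: subset_trans fN => x /= xlh.
  by move=> /(_ xlh) [] /eqP; rewrite gt_eqF// f0.
by rewrite N0 lebesgue_measure_itv/= lte_fin lh -EFinD lee_fin subr_le0 leNgt lh.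
Qed.

Lemma egamma_ge0 (al : R) : (0 <= egamma al)%E.
Proof. by rewrite egammaE; apply: integral_ge0 => x _; rewrite lee_fin gamma_density_ge0. Qed.

Lemma egamma_gt0 (al : R) : (0 < egamma al)%E.
Proof.
rewrite egammaE.
apply: (@lt_le_trans _ _ (\int[mu]_(x in `]0%R, 1%R[) (gamma_density al x)%:E)%E).
  apply: integral_itv_gt0 => //.
    by apply: measurable_funTS; exact: measurable_gamma_density.
  move=> x; rewrite in_itv/= /gamma_density => /andP[x0 _]; rewrite x0.
  by rewrite mulr_gt0 ?expR_gt0// powR_gt0.
apply: ge0_subset_integral => //.
  by apply/measurable_EFinP; exact: measurable_gamma_density.
by move=> x _; rewrite lee_fin gamma_density_ge0.
Qed.

Lemma integral_expRN :
  (\int[mu]_(x in `]0%R, +oo[) (expR (- x))%:E = 1)%E.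
Proof.
rewrite integral_itv_obnd_cbnd; last first.
  apply/measurable_EFinP; apply: measurable_funTS.
  exact: (measurableT_comp (@measurable_expR R)).
rewrite (@ge0_continuous_FTC2y R (fun x => expR (- x)) (fun x => - expR (- x)) 0 0).
- by rewrite oppr0 expR0 -EFinD sub0r opprK.
- by move=> x _; exact: expR_ge0.
- apply: continuous_subspaceT => x; apply: continuous_comp; last exact: continuous_expR.
  exact: opp_continuous.
- by rewrite -oppr0; apply: cvgN; exact: cvgr_expR.
- by move=> x _.
- apply: cvg_at_right_filter; apply: cvgN; apply: continuous_comp; last exact: continuous_expR.
  exact: opp_continuous.
- move=> x _; rewrite derive1E derive_val; rewrite /GRing.scale/=; ring.
Qed.

Lemma egamma1 : egamma (1 : R) = 1%E.
Proof.
rewrite -integral_expRN; apply: eq_integral => x _.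
by rewrite subrr powRr0 mul1r.
Qed.

Lemma ebeta1 (be : R) : 0 < be -> ebeta 1 be = (be^-1)%:E.
Proof.
move=> be0; have := integral_powR be0 ltr01; rewrite powR1 mul1r => <-.
by apply: eq_integral => x _; rewrite subrr powRr0 mul1r.
Qed.

(** The case [al = 1] of [egammaM], with B(1, be) = 1 / be, takes the place of an integration by
    parts. It holds in [\bar R] and so can serve to propagate finiteness. *)
Lemma egammaD1 (be : R) : 0 < be -> egamma (be + 1) = (be%:E * egamma be)%E.
Proof.
move=> be0; have := egammaM 1 be.
rewrite egamma1 mul1e ebeta1// addrC => ->.
by rewrite muleA -EFinM mulfV ?gt_eqF// mul1e.
Qed.

(** For exponents in []0, 1]] the density is dominated by [s ^ (x - 1)] on []0, 1[] plus
    [expR (- s)] on the half-line, both of known integral. The functional equation brings larger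
    exponents down to this range. *)
Lemma egamma_lty (al : R) : 0 < al -> (egamma al < +oo)%E.
Proof.
have base (x : R) : 0 < x -> x <= 1 -> (egamma x < +oo)%E.
  move=> x0 x1; rewrite egammaE.
  pose p (s : R) : R := (if (0 < s) && (s < 1) then s `^ (x - 1) else 0).
  pose e (s : R) : R := (if 0 < s then expR (- s) else 0).
  have mp : measurable_fun setT p.
    apply: measurable_fun_ifT => //.
    by apply: measurable_and;
      [apply: (@measurable_fun_ltr _ _ _ _ (cst 0) id)
      |apply: (@measurable_fun_ltr _ _ _ _ id (cst 1))].
  have me : measurable_fun setT e.
    apply: measurable_fun_ifT => //.
      by apply: measurable_fun_ltr.
    exact: (measurableT_comp (@measurable_expR R)).
  have p0 s : 0 <= p s by rewrite /p; case: ifP => // _; exact: powR_ge0.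
  have e0 s : 0 <= e s by rewrite /e; case: ifP => // _; exact: expR_ge0.
  apply: (@le_lt_trans _ _ (\int[mu]_s ((p s)%:E + (e s)%:E))%E).
    apply: ge0_le_integral => //.
    - by move=> s _; rewrite lee_fin gamma_density_ge0.
    - by apply/measurable_EFinP; exact: measurable_gamma_density.
    - by apply: emeasurable_funD; exact/measurable_EFinP.
    move=> s _; rewrite -EFinD lee_fin /gamma_density /p /e.
    case: (ltP 0 s) => s0 /=; last by rewrite addr0.
    case: (ltP s 1) => s1.
      rewrite -[leLHS]addr0 lerD ?expR_ge0// ler_piMr ?powR_ge0//.
      by rewrite -expR0 ler_expR oppr_le0 ltW.
    rewrite add0r ler_piMl ?expR_ge0//.
    by rewrite -[leRHS](powRr0 s) ler_powR// subr_le0.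
  rewrite ge0_integralD//; last 4 first.
  - by move=> s _; rewrite lee_fin.
  - exact/measurable_EFinP.
  - by move=> s _; rewrite lee_fin.
  - exact/measurable_EFinP.
  have -> : (\int[mu]_s (p s)%:E = (x^-1)%:E)%E.
    have := integral_powR x0 ltr01; rewrite powR1 mul1r => <-.
    rewrite [RHS]integral_mkcond; apply: eq_integral => s _.
    by rewrite patchE /p mem_setE in_itv/=; case: ifP.
  have -> : (\int[mu]_s (e s)%:E = 1)%E.
    rewrite -integral_expRN.
    rewrite [RHS]integral_mkcond; apply: eq_integral => s _.
    by rewrite patchE /e mem_setE in_itv/= andbT; case: ifP.
  by rewrite -EFinD ltry.
have main n (x : R) : 0 < x -> x <= n.+1%:R -> (egamma x < +oo)%E.
  elim: n x => [|n IH] x x0 xn; first exact: base.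
  have [x1|x1] := leP x 1; first exact: base.
  have x10 : 0 < x - 1 by rewrite subr_gt0.
  rewrite -(subrK 1 x) egammaD1// lte_mul_pinfty// ?lee_fin ?(ltW x10)//.
  by apply: IH => //; rewrite lerBlDr -natr1 in xn *.
move=> al0; apply: (main (Num.truncn al)) => //.
exact/ltW/truncnS_gt.
Qed.

Lemma EFin_Gamma (al : R) : 0 < al -> (Gamma al)%:E = egamma al.
Proof.
by move=> al0; rewrite Gamma_fine fineK// ge0_fin_numE ?egamma_ge0// egamma_lty.
Qed.

Lemma Gamma_gt0 (al : R) : 0 < al -> 0 < Gamma al.
Proof. by move=> al0; rewrite -lte_fin EFin_Gamma// egamma_gt0. Qed.

Lemma Gamma1 : Gamma (1 : R) = 1.
Proof. by rewrite Gamma_fine egamma1. Qed.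

Lemma ebetaE (al be : R) : 0 < al -> 0 < be ->
  ebeta al be = (Gamma al * Gamma be / Gamma (al + be))%:E.
Proof.
move=> al0 be0; have ab0 : 0 < al + be by rewrite addr_gt0.
rewrite EFinM EFinM !EFin_Gamma// egammaM -EFin_Gamma// -muleA -EFinM.
by rewrite mulfV ?mule1// gt_eqF// Gamma_gt0.
Qed.

End gamma_values.

(** * Derivatives relative to ]a, b] and kernel functions *)

Section one_sided_derivative.
Context {R : realType} (a b : R).

(** Near an interior point the restriction to []a, b]] is invisible, so the relative derivative is
    an ordinary one; this opens the way to the standard calculus theorems. *)
Lemma is_derive_derive_oc (f : R -> R) (t : R) : t \in `]a, b[ ->
  derivable_oc a b f t -> is_derive t 1 f (derive_oc a b f t).
Proof.
move=> tab df.
have shift_cvg : (h + t) @[h --> (0 : R)^'] --> within `]a, b] t^'.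
  have H : (h + t) @[h --> (0 : R)^'] --> t^'.
    apply: cvg_within_filter.
      rewrite -[X in _ --> X]add0r; apply: cvgD; last exact: cvg_cst.
      exact: nbhs_dnbhs.
    near=> h; rewrite -subr_eq0 addrK; near: h; exact: nbhs_dnbhs_neq.
  apply: cvg_trans H _ => A WA.
  have Dt : \forall y \near t^', y \in `]a, b].
    apply: nbhs_dnbhs; near=> y; apply: subset_itv_oo_oc; near: y.
    exact: near_in_itvoo.
  rewrite nbhs_filterE; have WA' : \forall y \near t^', y \in `]a, b] -> A y by exact: WA.
  by near=> y; apply: (near WA' y) => //; near: y.
have := cvg_comp _ _ shift_cvg df.
have -> : ((fun y => (f y - f t) / (y - t)) \o (fun h => h + t)) =
    fun h : R => h^-1 *: ((f \o shift t) (h *: 1) - f t).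
  by apply/funext => h /=; rewrite addrK mulrC /GRing.scale/= mulr1.
move=> H; apply: DeriveDef; first by apply/cvg_ex; exists (derive_oc a b f t).
exact/cvg_lim.
Unshelve. all: by end_near. Qed.

Lemma derivable_oc_continuous (f : R -> R) (t : R) : 
  derivable_oc a b f t -> f y @[y --> within `]a, b] (nbhs t)] --> f t.
Proof.
move=> df.
have H : ((f y - f t) / (y - t)) * (y - t) @[y --> within `]a, b] t^'] --> (0 : R).
  rewrite -[X in _ --> X](mulr0 (derive_oc a b f t)); apply: cvgM => //.
  rewrite -(subrr t); apply: cvgB; last exact: cvg_cst.
  by move=> A nA; apply: filterS (nbhs_dnbhs nA).
apply/cvgrPdist_lt => e e0.
have /cvgrPdist_lt/(_ e e0) H1 := H.
have {}H1 : nbhs t (fun y => y != t -> y \in `]a, b] ->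
    `|0 - (f y - f t) / (y - t) * (y - t)| < e) by exact: H1.
suff : nbhs t (fun y => y \in `]a, b] -> `|f t - f y| < e) by [].
apply: filterS H1 => y + Dy; have [->|yt] := eqVneq y t; first by rewrite subrr normr0.
by move=> /(_ isT Dy); rewrite sub0r normrN divfK ?subr_eq0// distrC.
Qed.

End one_sided_derivative.

(** * The kernel function as an increasing change of variables *)

Section kernel.
Context {R : realType} (a b : R) (ab : a < b) (psi : R -> R).
Hypothesis hk : kernel_function a b psi.
Notation p := (derive_oc a b psi).

Lemma kernel_is_derive : {in `]a, b[, forall t : R, is_derive t 1 psi (p t)}.
Proof.
move=> t tab; apply: is_derive_derive_oc => //; apply: (kernel_derivable hk).
exact: subset_itv_oo_oc.
Qed.

Lemma within_oc_continuous_oo (f : R -> R) :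
  {within `]a, b], continuous f} -> {in `]a, b[, continuous f}.
Proof.
move=> cf; apply/in_continuous_mksetP.
rewrite -continuous_open_subspace; last exact: interval_open.
by move: cf; apply/continuous_subspaceW; exact: subset_itvW.
Qed.

Lemma within_oc_left (f : R -> R) t : t \in `]a, b] ->
  f y @[y --> within `]a, b] (nbhs t)] --> f t -> f y @[y --> t^'-] --> f t.
Proof.
move=> /[!in_itv]/= /andP[ta tb] ft; apply: cvg_trans ft => A.
have Dt : \forall y \near t^'-, y \in `]a, b].
  near=> y; rewrite in_itv/=; apply/andP; split.
    by near: y; exact: nbhs_left_gt.
  by apply: ltW; apply: lt_le_trans tb; near: y; exact: nbhs_left_lt.
rewrite !nbhs_filterE /= => WA.
have WA' : \forall y \near t, y \in `]a, b] -> A (f y) by exact: WA.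
have WA'' : \forall y \near t^'-, y \in `]a, b] -> A (f y) by exact: cvg_within WA'.
by near=> y; apply: (near WA'' y) => //; near: y.
Unshelve. all: by end_near. Qed.

Lemma kernel_derive_cont : {in `]a, b[, continuous p}.
Proof. exact: within_oc_continuous_oo (kernel_derive_continuous hk). Qed.

Lemma kernel_derive_gt0 : {in `]a, b[, forall t, 0 < p t}.
Proof.
move=> t tab; rewrite lt_neqAle eq_sym (kernel_derive_neq0 hk) ?andTb; last first.
  exact: subset_itv_oo_oc.
have [dt <-] := kernel_is_derive tab.
rewrite limr_ge//; near=> h.
have hab : h + t \in `]a, b[.
  near: h; apply: nbhs_dnbhs.
  have : (h + t) @[h --> (0 : R)] --> t.
    by rewrite -[X in _ --> X]add0r; apply: cvgD; [exact: cvg_id|exact: cvg_cst].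
  by move=> /(_ _ (near_in_itvoo tab)).
rewrite /= [h *: 1]/GRing.scale/= mulr1 /GRing.scale/=.
have [h0|h0] := leP 0 h.
  rewrite mulr_ge0 ?invr_ge0// subr_ge0.
  by apply: (kernel_nondecreasing hk); rewrite ?subset_itv_oo_oc// lerDr.
rewrite mulr_le0 ?invr_le0 ?(ltW h0)// subr_le0.
by apply: (kernel_nondecreasing hk); rewrite ?subset_itv_oo_oc// gerDr ltW.
Unshelve. all: by end_near. Qed.

Lemma kernel_within : {within `[a, b], continuous psi}.
Proof.
apply/(continuous_within_itvP _ ab); split.
- exact: within_oc_continuous_oo (kernel_continuous hk).
- exact: kernel_at_a hk.
- apply: within_oc_left; first by rewrite in_itv/= ab lexx.
  have /subspace_continuousP := kernel_continuous hk; apply.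
  by rewrite /= in_itv/= ab lexx.
Qed.

Lemma kernel_lt : {in `[a, b] &, {homo psi : x y / x < y}}.
Proof.
move=> x y xab yab xy; apply: (@gtr0_derive1_lt_cc _ psi a b) => //.
- by move=> z /kernel_is_derive [].
- move=> z zab; have := kernel_is_derive zab => dz.
  by rewrite derive1E derive_val kernel_derive_gt0.
- exact: kernel_within.
Qed.

Lemma kernel_le : {in `[a, b] &, {homo psi : x y / x <= y}}.
Proof.
move=> x y xab yab; rewrite le_eqVlt => /predU1P[->//|xy].
by apply: ltW; exact: kernel_lt.
Qed.

Lemma kernel_cvg_right x : x \in `[a, b[ -> psi y @[y --> x^'+] --> psi x.
Proof.
rewrite in_itv/= => /andP[]; rewrite le_eqVlt => /predU1P[<- _|ax xb].
  exact: kernel_at_a hk.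
apply: cvg_at_right_filter; apply: (within_oc_continuous_oo (kernel_continuous hk)).
by rewrite in_itv/= ax.
Qed.

Lemma kernel_cvg_left x : x \in `]a, b] -> psi y @[y --> x^'-] --> psi x.
Proof.
move=> xab; apply: within_oc_left => //.
by have /subspace_continuousP := kernel_continuous hk; apply.
Qed.

Lemma ge0_kernel_substitution (G : R -> R) (r t : R) : a <= r -> r < t -> t <= b ->
  {in `]psi r, psi t[, continuous G} ->
  {in `]psi r, psi t[, forall x, 0 <= G x} ->
  (\int[lebesgue_measure]_(x in `]psi r, psi t[) (G x)%:E =
   \int[lebesgue_measure]_(x in `]r, t[) (G (psi x) * p x)%:E)%E.
Proof.
move=> ar rt tb cG G0.
have sub x : x \in `]r, t[ -> x \in `]a, b[.
  rewrite !in_itv/= => /andP[rx xt].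
  by rewrite (le_lt_trans ar) ?(lt_le_trans xt).
have subc x : x \in `[r, t] -> x \in `[a, b].
  rewrite !in_itv/= => /andP[rx xt].
  by rewrite (le_trans ar) ?(le_trans xt).
apply: ge0_integration_by_substitution_oo => //.
- by move=> x y xr yr; apply: kernel_lt; exact: subc.
- by move=> x /sub; exact: kernel_is_derive.
- by move=> x /sub; exact: kernel_derive_cont.
- by apply: kernel_cvg_right; rewrite in_itv/= ar (lt_le_trans rt).
- by apply: kernel_cvg_left; rewrite in_itv/= tb (le_lt_trans ar).
- by move=> x /sub /kernel_derive_gt0 /ltW.
Qed.

(** The substitution [x = psi s] turns this into the Beta integral over []psi r, psi t[]. The case
    [r = a] is included because the change of variables tolerates a singular derivative at the
    endpoint. *)
Lemma kernel_beta (al be r t : R) : 0 < al -> 0 < be ->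
    a <= r -> r < t -> t <= b ->
  (\int[lebesgue_measure]_(s in `]r, t[)
     (p s * (psi t - psi s) `^ (al - 1) * (psi s - psi r) `^ (be - 1))%:E =
   (Gamma al * Gamma be / Gamma (al + be) * (psi t - psi r) `^ (al + be - 1))%:E)%E.
Proof.
move=> al0 be0 ar rt tb.
have rab : r \in `[a, b] by rewrite in_itv/= ar ltW// (lt_le_trans rt).
have tab : t \in `[a, b] by rewrite in_itv/= tb ltW// (le_lt_trans ar).
have rt' := kernel_lt rab tab rt.
have := @ge0_integral_beta R al be _ _ rt'.
rewrite ebetaE// -EFinM mulrC => <-.
rewrite ge0_kernel_substitution//.
- by apply: eq_integral => s _; congr EFin; ring.
- move=> x; rewrite in_itv/= => /andP[lx xh]; apply: cvgM.
    apply: (@continuous_comp _ _ _ (fun x => psi t - x) (@powR R ^~ _)).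
      by apply: cvgB; [exact: cvg_cst|exact: cvg_id].
    by apply: continuous_powR_gt0; rewrite subr_gt0.
  apply: (@continuous_comp _ _ _ (fun x => x - psi r) (@powR R ^~ _)).
    by apply: cvgB; [exact: cvg_id|exact: cvg_cst].
  by apply: continuous_powR_gt0; rewrite subr_gt0.
- by move=> x _; rewrite mulr_ge0// powR_ge0.
Qed.

End kernel.

(** * Fractional integrals *)

(** A class containing the continuous functions on [[a, b]] and stable under fractional integration
    of order at most 1. Its members have integrable products with the kernel, even where the kernel
    is singular. *)
Definition bounded_measurable {R : realType} (a b : R) (w : R -> R) : Prop :=
  measurable_fun `]a, b[ w /\ exists M : R, {in `]a, b[, forall s, `|w s| <= M}.

Section fractional_integral.
Context {R : realType} (a b : R) (ab : a < b) (psi : R -> R).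
Hypothesis hk : kernel_function a b psi.
Notation p := (derive_oc a b psi).
Notation mu := (@lebesgue_measure R).
Notation bmf := (bounded_measurable a b).

Definition frac_kernel (g t s : R) : R :=
  p s * (psi t - psi s) `^ (g - 1) / Gamma g.

Let sub_ooab r t x : a <= r -> t <= b -> x \in `]r, t[ -> x \in `]a, b[.
Proof.
rewrite !in_itv/= => ar tb /andP[rx xt].
by rewrite (le_lt_trans ar) ?(lt_le_trans xt).
Qed.

Lemma measurable_kernel_derive : measurable_fun `]a, b[ p.
Proof.
apply: open_continuous_measurable_fun => // x; rewrite inE/=.
exact: kernel_derive_cont hk _.
Qed.

Lemma measurable_kernel : measurable_fun `]a, b[ psi.
Proof.
apply: open_continuous_measurable_fun => // x; rewrite inE/=.
exact: within_oc_continuous_oo (kernel_continuous hk) _.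
Qed.

Lemma measurable_frac_kernel (g t : R) :
  measurable_fun `]a, b[ (frac_kernel g t).
Proof.
apply: measurable_funM => //; apply: measurable_funM.
  exact: measurable_kernel_derive.
by apply: measurable_fun_powR => //; apply: measurable_funB => //; exact: measurable_kernel.
Qed.

Lemma frac_kernel_ge0 (g t s : R) : 0 < g -> s \in `]a, b[ -> 0 <= frac_kernel g t s.
Proof.
move=> g0 sab; rewrite divr_ge0 ?(ltW (Gamma_gt0 _))// mulr_ge0 ?powR_ge0//.
by rewrite ltW// kernel_derive_gt0.
Qed.

Lemma frac_kernel_gt0 (g t s : R) : 0 < g -> t \in `]a, b] -> s \in `]a, t[ ->
  0 < frac_kernel g t s.
Proof.
rewrite !in_itv/= => g0 /andP[ta tb] /andP[sa st].
have sb := lt_le_trans st tb.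
rewrite divr_gt0 ?Gamma_gt0// mulr_gt0 ?powR_gt0//.
  by apply: (kernel_derive_gt0 hk); rewrite in_itv/= sa.
by rewrite subr_gt0; apply: (kernel_lt ab hk); rewrite // in_itv/= ?(ltW sa) ?(ltW ta) ?(ltW sb).
Qed.

(* Taking [r = a] rules out the factor [p r] (there is no derivative at [a]),
   hence the second kernel appears without it. *)
Lemma frac_kernel_comp (al be r t : R) : 0 < al -> 0 < be ->
    a <= r -> r < t -> t <= b ->
  (\int[mu]_(s in `]r, t[)
    (frac_kernel al t s * ((psi s - psi r) `^ (be - 1) / Gamma be))%:E =
   ((psi t - psi r) `^ (al + be - 1) / Gamma (al + be))%:E)%E.
Proof.
move=> al0 be0 ar rt tb.
have Ga0 := Gamma_gt0 al0; have Gb0 := Gamma_gt0 be0.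
have Gab0 := Gamma_gt0 (addr_gt0 al0 be0).
pose c := (Gamma al * Gamma be)^-1.
have c0 : 0 <= c by rewrite invr_ge0; exact: ltW (mulr_gt0 Ga0 Gb0).
transitivity (c%:E * \int[mu]_(s in `]r, t[)
     (p s * (psi t - psi s) `^ (al - 1) * (psi s - psi r) `^ (be - 1))%:E)%E.
  rewrite -ge0_integralZl//.
  - apply: eq_integral => s _; rewrite -EFinM /c invfM /frac_kernel; congr EFin.
    by move: (p s) (_ `^ _) (_ `^ _) (Gamma al) (Gamma be) => *; ring.
  - apply/measurable_EFinP; apply: (@measurable_funS _ _ _ _ `]a, b[) => //.
      by move=> x /=; exact: sub_ooab.
    apply: measurable_funM; first apply: measurable_funM.
    + exact: measurable_kernel_derive.
    + by apply: measurable_fun_powR => //; apply: measurable_funB => //; exact: measurable_kernel.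
    + by apply: measurable_fun_powR => //; apply: measurable_funB => //; exact: measurable_kernel.
  - move=> s /= /(sub_ooab ar tb) sab; rewrite lee_fin !mulr_ge0 ?powR_ge0//.
    by rewrite ltW// (kernel_derive_gt0 hk).
rewrite (kernel_beta ab hk)// -EFinM /c; congr EFin.
move: (Gamma al) (Gamma be) (Gamma _) (_ `^ _) Ga0 Gb0 Gab0 => A B C D A0 B0 C0.
by field; rewrite !gt_eqF.
Qed.

(** This is [frac_kernel_comp] with [be = 1], whose second factor is then identically 1. *)
Lemma integral_frac_kernel (g r t : R) : 0 < g -> a <= r -> r < t -> t <= b ->
  (\int[mu]_(s in `]r, t[) (frac_kernel g t s)%:E =
   ((psi t - psi r) `^ g / Gamma (g + 1))%:E)%E.
Proof.
move=> g0 ar rt tb; have E := frac_kernel_comp g0 ltr01 ar rt tb.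
rewrite (addrK 1 g) in E; apply: etrans E; apply: eq_integral => s _; congr EFin.
by rewrite subrr powRr0 Gamma1 divr1 mulr1.
Qed.

Lemma integrable_frac_kernel (g r t : R) : 0 < g -> a <= r -> r < t -> t <= b ->
  mu.-integrable `]r, t[ (EFin \o frac_kernel g t).
Proof.
move=> g0 ar rt tb; apply/integrableP; split.
  apply/measurable_EFinP; apply: (@measurable_funS _ _ _ _ `]a, b[) => //.
    by move=> x /=; exact: sub_ooab.
  exact: measurable_frac_kernel.
have E := integral_frac_kernel g0 ar rt tb.
have -> : (\int[mu]_(s in `]r, t[) `|(EFin \o frac_kernel g t) s| =
    \int[mu]_(s in `]r, t[) (frac_kernel g t s)%:E)%E.
  apply: eq_integral => s; rewrite inE/= => /(sub_ooab ar tb) sab.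
  by congr EFin; apply: ger0_norm; exact: frac_kernel_ge0.
by rewrite E ltry.
Qed.

Lemma integrable_frac_kernelM (g r t : R) (w : R -> R) : bmf w -> 0 < g ->
    a <= r -> r < t -> t <= b ->
  mu.-integrable `]r, t[ (fun s => (frac_kernel g t s * w s)%:E).
Proof.
move=> [mw [M wM]] g0 ar rt tb.
apply: (@le_integrable _ _ _ mu _ _ _ (fun s => M%:E * (frac_kernel g t s)%:E)%E) => //.
- apply/measurable_EFinP; apply: (@measurable_funS _ _ _ _ `]a, b[) => //.
    by move=> x /=; exact: sub_ooab.
  by apply: measurable_funM => //; exact: measurable_frac_kernel.
- move=> s /= /(sub_ooab ar tb) sab; rewrite lee_fin normrM [leRHS]normrM mulrC.
  by rewrite ler_wpM2r// (le_trans (wM _ sab))// ler_norm.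
- by apply: integrableZl => //; exact: integrable_frac_kernel.
Qed.

(** The real integral in [frac_int] is a [fine], which would send an infinite value to 0;
    integrability for bounded [w] shows that this does not occur. *)
Lemma EFin_frac_int (g t : R) (w : R -> R) : bmf w -> 0 < g -> t \in `]a, b] ->
  ((frac_int a b psi g w t)%:E =
   \int[mu]_(s in `]a, t[) (frac_kernel g t s * w s)%:E)%E.
Proof.
rewrite in_itv/= => bw g0 /andP[ta tb].
have Gg0 := Gamma_gt0 g0.
rewrite /frac_int gt_eqF// /Rintegral.
have intw := integrable_frac_kernelM bw g0 (lexx a) ta tb.
transitivity ((Gamma g)^-1%:E * \int[mu]_(s in `]a, t[) ((Gamma g)%:E * (frac_kernel g t s * w s)%:E))%E.
  have E : (\int[mu]_(s in `]a, t[) (p s * w s / (psi t - psi s) `^ (1 - g))%:E =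
      \int[mu]_(s in `]a, t[) ((Gamma g)%:E * (frac_kernel g t s * w s)%:E))%E.
    apply: eq_integral => s _; rewrite -EFinM; congr EFin.
    rewrite -powRN opprB /frac_kernel; field; by rewrite gt_eqF.
  rewrite -E EFinM fineK// E integralZl//.
  by rewrite fin_numM// integrable_fin_num.
by rewrite integralZl// muleA -EFinM mulVf ?mul1e// gt_eqF.
Qed.

Lemma frac_int_eq (g t : R) (w1 w2 : R -> R) : 0 < g -> {in `]a, t[, w1 =1 w2} ->
  frac_int a b psi g w1 t = frac_int a b psi g w2 t.
Proof.
move=> g0 w12; rewrite /frac_int gt_eqF//; congr (_ * _).
by apply: eq_Rintegral => s; rewrite inE/= => sat; rewrite w12.
Qed.

Lemma bounded_measurableD (w1 w2 : R -> R) : bmf w1 -> bmf w2 -> bmf (fun s => w1 s + w2 s).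
Proof.
move=> [m1 [M1 b1]] [m2 [M2 b2]]; split; first exact: measurable_funD.
exists (M1 + M2) => s sab; rewrite (le_trans (ler_normD _ _))// lerD ?b1 ?b2//.
Qed.

Lemma bounded_measurable_cst (c : R) : bmf (fun=> c).
Proof. by split; [exact: measurable_cst|exists `|c|]. Qed.

Lemma bounded_measurableN (w : R -> R) : bmf w -> bmf (fun s => - w s).
Proof.
move=> [m [M b1]]; split; first exact: measurable_funN.
by exists M => s sab; rewrite normrN b1.
Qed.

Lemma frac_intD (g t : R) (w1 w2 : R -> R) : bmf w1 -> bmf w2 -> 0 < g ->
  t \in `]a, b] ->
  frac_int a b psi g (fun s => w1 s + w2 s) t =
  frac_int a b psi g w1 t + frac_int a b psi g w2 t.
Proof.
move=> b1 b2 g0 tab; apply: EFin_inj; rewrite EFinD !EFin_frac_int//; last exact: bounded_measurableD.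
move: tab; rewrite in_itv/= => /andP[ta tb].
rewrite -integralD//; [|exact: integrable_frac_kernelM|exact: integrable_frac_kernelM].
by apply: eq_integral => s _; rewrite mulrDr EFinD.
Qed.

Lemma frac_int_cst (g t c : R) : 0 < g -> t \in `]a, b] ->
  frac_int a b psi g (fun=> c) t = c / Gamma (g + 1) * (psi t - psi a) `^ g.
Proof.
move=> g0 tab; apply: EFin_inj; rewrite EFin_frac_int//; last exact: bounded_measurable_cst.
move: tab; rewrite in_itv/= => /andP[ta tb].
transitivity (c%:E * \int[mu]_(s in `]a, t[) (frac_kernel g t s)%:E)%E.
  rewrite -integralZl//; last exact: integrable_frac_kernel.
  by apply: eq_integral => s _; rewrite -EFinM mulrC.
by rewrite integral_frac_kernel// -EFinM; congr EFin; ring.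
Qed.

Lemma le_frac_int (g t r M : R) (w : R -> R) : bmf w ->
  {in `]a, b[, forall s, `|w s| <= M} -> 0 < g ->
  a <= r -> r < t -> t <= b ->
  (`|\int[mu]_(s in `]r, t[) (frac_kernel g t s * w s)%:E| <=
   (M * ((psi t - psi r) `^ g / Gamma (g + 1)))%:E)%E.
Proof.
move=> bw wM g0 ar rt tb.
have iw := integrable_frac_kernelM bw g0 ar rt tb.
apply: (le_trans (le_abse_integral _ _ _)) => //; first exact: measurable_int iw.
rewrite EFinM -integral_frac_kernel// -integralZl//; last exact: integrable_frac_kernel.
apply: ge0_le_integral => //.
- by apply: measurableT_comp => //; exact: measurable_int iw.
- apply: (@measurable_int _ _ _ mu); apply: integrableZl => //.
  exact: integrable_frac_kernel.
move=> s /= /(sub_ooab ar tb) sab; rewrite lee_fin normrM mulrC.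
have k0 := frac_kernel_ge0 t g0 sab.
by rewrite (ger0_norm k0) ler_wpM2r// wM.
Qed.

End fractional_integral.

(** * Hoelder continuity of fractional integrals *)

Section frac_int_continuous.
Context {R : realType} (a b : R) (ab : a < b) (psi : R -> R).
Hypothesis hk : kernel_function a b psi.
Notation mu := (@lebesgue_measure R).
Notation bmf := (bounded_measurable a b).
Notation k := (frac_kernel a b psi).
Notation I := (frac_int a b psi).

Lemma frac_intE (g t : R) (w : R -> R) : bmf w -> 0 < g -> t \in `]a, b] ->
  I g w t = \int[mu]_(s in `]a, t[) (k g t s * w s).
Proof. by move=> bw g0 tab; rewrite /Rintegral -(EFin_frac_int ab hk). Qed.

Lemma le_abs_frac_int (g t r M : R) (w : R -> R) : bmf w ->
  {in `]a, b[, forall s, `|w s| <= M} -> 0 < g -> a <= r -> r < t -> t <= b ->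
  `|\int[mu]_(s in `]r, t[) (k g t s * w s)| <=
   M * ((psi t - psi r) `^ g / Gamma (g + 1)).
Proof.
move=> bw wM g0 ar rt tb; have := le_frac_int ab hk bw wM g0 ar rt tb.
rewrite -lee_fin /Rintegral => H; apply: le_trans H.
rewrite -[leRHS]/(`|_|%E) -abse_EFin fineK// .
by apply: integrable_fin_num => //; exact: (integrable_frac_kernelM ab hk).
Qed.

Lemma Rintegral_frac_kernel (g r t : R) : 0 < g -> a <= r -> r < t -> t <= b ->
  \int[mu]_(s in `]r, t[) k g t s = (psi t - psi r) `^ g / Gamma (g + 1).
Proof. by move=> *; rewrite /Rintegral (integral_frac_kernel ab hk). Qed.

Lemma Rintegral_oo_split (f : R -> R) (x y z : R) : x < y -> y < z ->
  mu.-integrable `]x, z[ (EFin \o f) ->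
  \int[mu]_(s in `]x, z[) f s = \int[mu]_(s in `]x, y[) f s + \int[mu]_(s in `]y, z[) f s.
Proof.
move=> xy yz intf.
have := @Rintegral_itvB R f (BRight x) (BLeft z) y intf.
rewrite !bnd_simp => /(_ (ltW xy) yz) <-.
rewrite [X in _ = X + _]Rintegral_itv_bndo_bndc; last first.
  by apply: integrableS intf => //; apply: subset_itvl; rewrite bnd_simp ltW.
by rewrite addrC subrK.
Qed.

(** Since [g - 1 <= 0], moving the upper endpoint away lowers the power. This fixes the sign of the
    kernel difference in [frac_int_holder]. *)
Lemma frac_kernel_le (g r t s : R) : 0 < g -> g <= 1 -> a < s -> s < r -> r < t -> t <= b ->
  k g t s <= k g r s.
Proof.
move=> g0 g1 as_ sr rt tb.
have sab : s \in `]a, b[ by rewrite in_itv/= as_ (lt_trans sr) ?(lt_le_trans rt).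
have rt0 : r \in `[a, b] by rewrite in_itv/= !ltW// ?(lt_le_trans rt)// (lt_trans as_).
have t0 : t \in `[a, b] by rewrite in_itv/= tb ltW// (lt_trans as_)// (lt_trans sr).
have s0 : s \in `[a, b] by exact: subset_itv_oo_cc.
have psr := kernel_lt ab hk s0 rt0 sr; have prt := kernel_lt ab hk rt0 t0 rt.
apply: ler_wpM2r; first by rewrite invr_ge0; exact: ltW (Gamma_gt0 g0).
apply: ler_wpM2l; first by rewrite ltW// (kernel_derive_gt0 hk).
rewrite -(opprB 1 g) !powRN lef_pV2 ?posrE ?powR_gt0 ?subr_gt0//; last exact: lt_trans prt.
by apply: ge0_ler_powR; rewrite ?nnegrE ?subr_ge0 ?lerD2r ?(ltW psr) ?(ltW prt)// (le_trans (ltW psr))// ltW.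
Qed.

(** The increment is the integral over []r, t[] plus that of a kernel difference over []a, r[]. The
    first is at most [M * K]. In the second the kernel difference has constant sign, so its absolute
    integral is computed exactly and again is at most [K]; hence the factor 2. *)
Lemma frac_int_holder (g r t M : R) (w : R -> R) : bmf w ->
  {in `]a, b[, forall s, `|w s| <= M} -> 0 < g -> g <= 1 ->
  a < r -> r < t -> t <= b ->
  `|I g w t - I g w r| <= (M * 2 / Gamma (g + 1)) * (psi t - psi r) `^ g.
Proof.
move=> bw wM g0 g1 ar rt tb.
have at_ : a < t := lt_trans ar rt.
have rb : r < b := lt_le_trans rt tb.
have sub x : x \in `]a, r[ -> x \in `]a, b[.
  by rewrite !in_itv/= => /andP[-> /lt_trans ->].
have M0 : 0 <= M.
  have rab : r \in `]a, b[ by rewrite in_itv/= ar.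
  exact: le_trans (normr_ge0 _) (wM _ rab).
have tab : t \in `]a, b] by rewrite in_itv/= at_.
have rab : r \in `]a, b] by rewrite in_itv/= ar ltW.
pose K := (psi t - psi r) `^ g / Gamma (g + 1).
have G1 : 0 < Gamma (g + 1) by apply: Gamma_gt0; rewrite addr_gt0.
have ikt := integrable_frac_kernelM ab hk bw g0 (lexx a) at_ tb.
have ikr := integrable_frac_kernelM ab hk bw g0 (lexx a) ar (ltW rb).
have jkt := integrable_frac_kernel ab hk g0 (lexx a) at_ tb.
have jkr := integrable_frac_kernel ab hk g0 (lexx a) ar (ltW rb).
have subI : `]a, r[ `<=` `]a, t[ by apply: subset_itvl; rewrite bnd_simp ltW.
have ikt' : mu.-integrable `]a, r[ (fun s => (k g t s * w s)%:E) by exact: integrableS ikt.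
have jkt' : mu.-integrable `]a, r[ (EFin \o k g t) by exact: integrableS jkt.
rewrite !frac_intE//.
rewrite (Rintegral_oo_split ar rt)// -addrA addrC -addrA.
have twoK (V W : R) : M * 2 / V * W = M * (W / V) + M * (W / V) by ring.
rewrite [leRHS]twoK.
apply: (le_trans (ler_normD _ _)); apply: lerD; last first.
  rewrite addrC -RintegralB//.
  have jB : mu.-integrable `]a, r[ (EFin \o (fun s => k g r s - k g t s)).
    by rewrite (_ : _ \o _ = ((EFin \o k g r) \- (EFin \o k g t))%E)//; exact: integrableB.
  have iB : mu.-integrable `]a, r[ (EFin \o (fun s => k g t s * w s - k g r s * w s)).
    by rewrite (_ : _ \o _ = ((EFin \o (fun s => (k g t s * w s)%R)) \- (EFin \o (fun s => (k g r s * w s)%R)))%E)//; exact: integrableB.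
  apply: (le_trans (le_normr_Rintegral _ _)) => //.
  apply: (@le_trans _ _ (\int[mu]_(s in `]a, r[) (M * (k g r s - k g t s)))).
    apply: le_Rintegral => //.
    - exact: integrable_norm.
    - exact: (integrableZl _ M jB).
    move=> s /= sr; have sab := sub _ sr.
    rewrite -mulrBl normrM mulrC ler_pM// ?wM// distrC ger0_norm// subr_ge0.
    by move: sr; rewrite in_itv/= => /andP[as_ sr]; exact: frac_kernel_le.
  rewrite RintegralZl// ler_wpM2l// RintegralB//.
  have E := Rintegral_oo_split ar rt jkt.
  rewrite !Rintegral_frac_kernel ?(ltW ar) ?(ltW rb)// in E *.
  have -> : \int[mu]_(s in `]a, r[) k g t s = (psi t - psi a) `^ g / Gamma (g + 1) - K.
    by rewrite E addrK.
  have aab : a \in `[a, b] by rewrite in_itv/= lexx ltW.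
  have pra : psi a <= psi r.
    by rewrite ltW// (kernel_lt ab hk)// in_itv/= !ltW.
  have ptr : psi r <= psi t.
    by rewrite ltW// (kernel_lt ab hk)// in_itv/= ?tb ?ltW.
  (* The exact value is [K] plus the difference of the [g]-th powers of [psi r - psi a] and
     [psi t - psi a], which is nonpositive. *)
  rewrite opprB addrCA gerDl subr_le0 ler_wpM2r// ?invr_ge0 ?(ltW G1)//.
  apply: ge0_ler_powR; rewrite ?nnegrE ?subr_ge0 ?lerD2r ?(ltW g0)//.
  exact: le_trans ptr.
by apply: le_abs_frac_int => //; exact: ltW.
Qed.

Lemma frac_int_continuous (g t : R) (w : R -> R) : bmf w -> 0 < g -> g <= 1 ->
  t \in `]a, b] -> I g w y @[y --> within `]a, b] (nbhs t)] --> I g w t.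
Proof.
move=> bw g0 g1 tab; have [M wM] := bw.2.
have M0 : 0 <= M.
  have mab : (a + b) / 2 \in `]a, b[ by rewrite in_itv/=; move: ab => ?; lra.
  exact: le_trans (normr_ge0 _) (wM _ mab).
set C := M * 2 / Gamma (g + 1).
have C0 : 0 <= C.
  by rewrite divr_ge0 ?mulr_ge0//; apply/ltW/Gamma_gt0; rewrite addr_gt0.
have holder y : y \in `]a, b] -> y != t ->
    0 < `|psi t - psi y| /\ `|I g w t - I g w y| <= C * `|psi t - psi y| `^ g.
  move: tab; rewrite !in_itv/= => /andP[at_ tb] /andP[ay yb].
  have tab : t \in `[a, b] by rewrite in_itv/= tb ltW.
  have yab : y \in `[a, b] by rewrite in_itv/= yb ltW.
  rewrite neq_lt => /orP[yt|ty].
    have pyt := kernel_lt ab hk yab tab yt.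
    by rewrite gtr0_norm ?subr_gt0//; split=> //; exact: frac_int_holder.
  have pyt := kernel_lt ab hk tab yab ty.
  by rewrite (distrC (psi t)) (distrC (I g w t)) gtr0_norm ?subr_gt0//; split=> //; exact: frac_int_holder.
apply/cvgrPdist_lt => e e0.
(* [C] vanishes when [M = 0], so the tolerance is divided by [C + 1]. *)
have C10 : 0 < C + 1 by rewrite ltr_wpDl.
have [d /= d0 dP] : exists2 d : R, 0 < d & forall x, 0 < x -> x < d -> x `^ g < e / (C + 1).
  have /cvgrPdist_lt/(_ _ (divr_gt0 e0 C10))[d /= d0 dP] := powR_cvg0 g0.
  exists d => // x x0 xd; have := dP x; rewrite /= !sub0r !normrN !ger0_norm ?powR_ge0 ?ltW//.
  by apply.
have cpsi : psi y @[y --> within `]a, b] (nbhs t)] --> psi t.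
  by have /subspace_continuousP := kernel_continuous hk; apply.
have /cvgrPdist_lt/(_ _ d0) H := cpsi.
have Hab : \forall y \near within `]a, b] (nbhs t), y \in `]a, b].
  by apply: withinT.
near=> y.
have yab : y \in `]a, b] by near: y.
have [->|yt] := eqVneq y t; first by rewrite subrr normr0.
have [p0 /le_lt_trans] := holder y yab yt; apply.
apply: (@le_lt_trans _ _ ((C + 1) * `|psi t - psi y| `^ g)).
  by rewrite ler_wpM2r ?powR_ge0// lerDl.
rewrite -ltr_pdivlMl// mulrC; apply: dP => //.
by near: y.
Unshelve. all: by end_near. Qed.

(** Measurability is drawn from continuity, hence the bound on the order; the sup bound compares
    [psi t - psi a] with [psi b - psi a]. *)
Lemma bounded_measurable_frac_int (g : R) (w : R -> R) : bmf w -> 0 < g -> g <= 1 -> bmf (I g w).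
Proof.
move=> bw g0 g1; split.
  apply: open_continuous_measurable_fun => // t; rewrite inE/= => tab.
  apply: (@within_oc_continuous_oo _ a b (I g w)) => //.
  by apply/subspace_continuousP => x xab; exact: frac_int_continuous.
have [M wM] := bw.2.
exists (M * ((psi b - psi a) `^ g / Gamma (g + 1))) => t tab.
have tab' : t \in `]a, b] by exact: subset_itv_oo_oc.
have tcc : t \in `[a, b] by exact: subset_itv_oo_cc.
have [acc bcc] : a \in `[a, b] /\ b \in `[a, b] by rewrite !in_itv/= !lexx !ltW.
have M0 : 0 <= M by exact: le_trans (normr_ge0 _) (wM _ tab).
move: (tab'); rewrite in_itv/= => /andP[at_ tb].
rewrite frac_intE//; apply: (le_trans (le_abs_frac_int bw wM g0 (lexx a) at_ tb)).
have G1 : 0 < Gamma (g + 1) by apply: Gamma_gt0; rewrite addr_gt0.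
apply: ler_wpM2l => //; apply: ler_wpM2r; first by rewrite invr_ge0; exact: ltW.
have pat := kernel_le ab hk acc tcc (ltW at_); have ptb := kernel_le ab hk tcc bcc tb.
apply: ge0_ler_powR; rewrite ?nnegrE ?subr_ge0 ?lerD2r ?(ltW g0)//.
exact: le_trans ptb.
Qed.

End frac_int_continuous.

(** * The semigroup law by Fubini's theorem *)

Section semigroup.
Context {R : realType} (a b : R) (ab : a < b) (psi : R -> R).
Hypothesis hk : kernel_function a b psi.
Notation p := (derive_oc a b psi).
Notation mu := (@lebesgue_measure R).
Notation bmf := (bounded_measurable a b).
Notation k := (frac_kernel a b psi).
Notation I := (frac_int a b psi).

(* [psi] and its derivative are cut off outside ]a, b[, where they are junk,
   to make this function measurable on the whole plane. *)
Definition iterated_kernel (al be t : R) (z : R * R) : R :=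
  if [&& a < z.2, z.2 < z.1 & z.1 < t] then
    ((p \_ `]a, b[) z.1 * (psi t - (psi \_ `]a, b[) z.1) `^ (al - 1) / Gamma al) *
    ((p \_ `]a, b[) z.2 * ((psi \_ `]a, b[) z.1 - (psi \_ `]a, b[) z.2) `^ (be - 1) / Gamma be)
  else 0.

Lemma measurable_iterated_kernel (al be t : R) :
  measurable_fun setT (iterated_kernel al be t).
Proof.
have mp : measurable_fun setT (p \_ `]a, b[).
  by apply/(measurable_restrictT _ _).1 => //; exact: measurable_kernel_derive hk.
have mq : measurable_fun setT (psi \_ `]a, b[).
  by apply/(measurable_restrictT _ _).1 => //; exact: measurable_kernel hk.
have m1 (f : R -> R) : measurable_fun setT f -> measurable_fun setT (fun z : R * R => f z.1).
  by move=> mf; apply: measurableT_comp => //; exact: measurable_fst.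
have m2 (f : R -> R) : measurable_fun setT f -> measurable_fun setT (fun z : R * R => f z.2).
  by move=> mf; apply: measurableT_comp => //; exact: measurable_snd.
apply: measurable_fun_ifT => //.
  apply: measurable_and; first by apply: measurable_fun_ltr => //; exact: measurable_snd.
  apply: measurable_and; apply: measurable_fun_ltr => //.
apply: measurable_funM; (apply: measurable_funM => //; apply: measurable_funM).
- exact: m1.
- apply: measurable_fun_powR => //; apply: measurable_funB => //; exact: m1.
- exact: m2.
- by apply: measurable_fun_powR => //; apply: measurable_funB; [exact: m1|exact: m2].
Qed.

Lemma iterated_kernelE (al be t s r : R) : t <= b ->
  iterated_kernel al be t (s, r) =
  if [&& a < r, r < s & s < t] then k al t s * k be s r else 0.
Proof.
move=> tb; rewrite /iterated_kernel/=; case: ifPn => // /and3P[ar rs st].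
have sab : s \in `]a, b[%classic by rewrite inE/= in_itv/= (lt_trans ar)//= (lt_le_trans st).
have rab : r \in `]a, b[%classic.
  by rewrite inE/= in_itv/= ar/= (lt_trans rs)// (lt_le_trans st).
by rewrite !patchE sab rab.
Qed.

Lemma iterated_kernel_ge0 (al be t : R) z : 0 < al -> 0 < be -> t <= b ->
  0 <= iterated_kernel al be t z.
Proof.
move=> al0 be0 tb; case: z => s r; rewrite iterated_kernelE//.
case: ifPn => // /and3P[ar rs st].
have sb : s < b := lt_le_trans st tb.
apply: mulr_ge0; apply: (frac_kernel_ge0 hk) => //; rewrite in_itv/=.
  by rewrite (lt_trans ar).
by rewrite ar (lt_trans rs).
Qed.

Lemma integral_iterated_kernel_snd (al be t s : R) (w : R -> R) : bmf w ->
    0 < be -> be <= 1 -> t <= b ->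
  (\int[mu]_r (iterated_kernel al be t (s, r) * (w \_ `]a, b[) r)%:E =
   ((fun s => (k al t s * I be w s)%:E) \_ `]a, t[) s)%E.
Proof.
move=> bw be0 be1 tb; rewrite patchE mem_setE in_itv/=.
have [|/negbTE sat] := boolP (a < s < t); last first.
  apply: integral0_eq => r _; rewrite iterated_kernelE//.
  case: ifPn => [/and3P[ar rs st]|_]; last by rewrite mul0r.
  by move: sat; rewrite (lt_trans ar rs) st.
move=> /andP[as_ st]; have sb : s < b := lt_le_trans st tb.
have sab : s \in `]a, b] by rewrite in_itv/= as_ ltW.
rewrite EFinM (EFin_frac_int ab hk)// -integralZl//; last first.
  by apply: (integrable_frac_kernelM ab hk) => //; exact: ltW.
rewrite [RHS]integral_mkcond; apply: eq_integral => r _.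
rewrite patchE mem_setE in_itv/= iterated_kernelE// st andbT.
case: ifPn => [/andP[ar rs]|]; last by rewrite mul0r.
rewrite patchE ifT; last by rewrite inE/= in_itv/= ar (lt_trans rs).
by rewrite -mulrA EFinM.
Qed.

(** The factor [p r * w r] does not depend on [s]; what remains under the integral is the
    composition of kernels on []r, t[], evaluated by the Beta integral. *)
Lemma integral_iterated_kernel_fst (al be t r : R) (w : R -> R) :
    0 < al -> 0 < be -> t <= b ->
  (\int[mu]_s (iterated_kernel al be t (s, r) * (w \_ `]a, b[) r)%:E =
   ((fun r => (k (al + be) t r * w r)%:E) \_ `]a, t[) r)%E.
Proof.
move=> al0 be0 tb; rewrite [in RHS]patchE mem_setE in_itv/=.
have [|/negbTE rat] := boolP (a < r < t); last first.
  apply: integral0_eq => s _; rewrite iterated_kernelE//.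
  case: ifPn => [/and3P[ar rs st]|_]; last by rewrite mul0r.
  by move: rat; rewrite (lt_trans rs st) ar.
move=> /andP[ar rt]; have rb : r < b := lt_le_trans rt tb.
have C := frac_kernel_comp ab hk al0 be0 (ltW ar) rt tb.
have mk : measurable_fun `]r, t[ (fun s => k al t s * ((psi s - psi r) `^ (be - 1) / Gamma be)).
  have sub : `]r, t[ `<=` `]a, b[.
    by apply: subset_itv; rewrite bnd_simp// ltW.
  apply: measurable_funM; first by apply: measurable_funS (measurable_frac_kernel hk _ _).
  apply: measurable_funM => //; apply: measurable_fun_powR => //; apply: measurable_funB => //.
  exact: measurable_funS (measurable_kernel hk).
transitivity ((p r * w r)%:E * \int[mu]_(s in `]r, t[)
    (k al t s * ((psi s - psi r) `^ (be - 1) / Gamma be))%:E)%E; last first.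
  rewrite C -EFinM; congr EFin; rewrite /frac_kernel.
  by move: (p r) (w r) (_ `^ _) (Gamma _) => *; ring.
rewrite -integralZl//; last first.
  apply/integrableP; split; first exact/measurable_EFinP.
  rewrite (_ : (\int[mu]_(s in _) _)%E = ((psi t - psi r) `^ (al + be - 1) / Gamma (al + be))%:E) ?ltry//.
  rewrite -C; apply: eq_integral => s; rewrite inE/= in_itv/= => /andP[rs st].
  congr EFin; apply: ger0_norm; rewrite mulr_ge0//.
    by rewrite (frac_kernel_ge0 hk)// in_itv/= (lt_trans ar)//= (lt_le_trans st).
  by rewrite divr_ge0 ?powR_ge0//; exact: ltW (Gamma_gt0 _).
rewrite [RHS]integral_mkcond; apply: eq_integral => s _.
rewrite !patchE !mem_setE !in_itv/= ar rb iterated_kernelE// ar/=.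
case: ifPn => _; last by rewrite mul0r.
rewrite -EFinM; congr EFin; rewrite {2}/frac_kernel.
by move: (k _ _ _) (p r) (w r) (_ `^ _) (Gamma _) => *; ring.
Qed.

(** The case [w = 1] is nonnegative, and integrating over [s] first leaves the kernel of order
    [al + be], whose integral is finite. A bounded [w] is dominated by [M] times that case. *)
Lemma integrable_iterated_kernel (al be t : R) (w : R -> R) : bmf w ->
    0 < al -> 0 < be -> t \in `]a, b] ->
  (mu \x mu)%E.-integrable setT
    (fun z : R * R => (iterated_kernel al be t z * (w \_ `]a, b[) z.2)%:E).
Proof.
move=> [mw [M wM]] al0 be0; rewrite in_itv/= => /andP[at_ tb].
have M0 : 0 <= M.
  have mab : (a + b) / 2 \in `]a, b[ by rewrite in_itv/=; move: ab => ?; lra.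
  exact: le_trans (normr_ge0 _) (wM _ mab).
pose one : R -> R := fun=> 1.
have i1 : (mu \x mu)%E.-integrable setT
    (fun z : R * R => (iterated_kernel al be t z * (one \_ `]a, b[) z.2)%:E).
  apply/integrable21ltyP.
    apply/measurable_EFinP; apply: measurable_funM; first exact: measurable_iterated_kernel.
    apply: (@measurableT_comp _ _ _ _ _ _ (one \_ `]a, b[)) => //.
    by apply/(measurable_restrictT _ _).1 => //; exact: measurable_cst.
  rewrite (_ : (\int[mu]_x _)%E =
      \int[mu]_r ((fun r => (k (al + be) t r * one r)%:E) \_ `]a, t[) r)%E.
    rewrite -integral_mkcond.
    under eq_integral do rewrite mulr1.
    by rewrite (integral_frac_kernel ab hk) ?addr_gt0// ltry.
  apply: eq_integral => r _; rewrite -integral_iterated_kernel_fst//.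
  apply: eq_integral => s _; congr EFin; apply: ger0_norm.
  rewrite mulr_ge0// ?iterated_kernel_ge0// patchE; by case: ifP.
apply: (le_integrable measurableT _ _ (integrableZl measurableT M i1)); last first.
- move=> z _; rewrite -EFinM lee_fin !patchE; case: ifPn; last by rewrite !mulr0.
  rewrite inE/= => zab; rewrite mulr1 normrM (normrM M) mulrC ler_wpM2r//.
  by rewrite (le_trans (wM _ zab))// ler_norm.
apply/measurable_EFinP; apply: measurable_funM; first exact: measurable_iterated_kernel.
apply: (@measurableT_comp _ _ _ _ _ _ (w \_ `]a, b[)) => //.
exact/(measurable_restrictT _ _).1.
Qed.

Lemma frac_int_semigroup (al be t : R) (w : R -> R) : bmf w ->
    0 < al -> 0 < be -> be <= 1 -> t \in `]a, b] ->
  I al (I be w) t = I (al + be) w t.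
Proof.
move=> bw al0 be0 be1 tab; have /andP[at_ tb] : (a < t) && (t <= b) by [].
have bI := bounded_measurable_frac_int ab hk bw be0 be1.
apply: EFin_inj.
rewrite (EFin_frac_int ab hk bI al0 tab) (EFin_frac_int ab hk bw (addr_gt0 al0 be0) tab).
rewrite integral_mkcond [RHS]integral_mkcond.
pose f (z : R * R) := (iterated_kernel al be t z * (w \_ `]a, b[) z.2)%:E.
transitivity (\int[mu]_s \int[mu]_r f (s, r))%E.
  by apply: eq_integral => s _; rewrite [RHS]integral_iterated_kernel_snd.
transitivity (\int[mu]_r \int[mu]_s f (s, r))%E.
  exact: Fubini (integrable_iterated_kernel bw al0 be0 tab).
by apply: eq_integral => r _; rewrite [LHS]integral_iterated_kernel_fst.
Qed.

End semigroup.

(** * Inversion of the Caputo derivative and Taylor's formula *)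

Section weighted_mean_value.
Context {R : realType}.
Notation mu := (@lebesgue_measure R).

Lemma in_itvoo_trans (l h x y z : R) : x \in `]l, h[ -> y \in `]l, h[ ->
  x <= z <= y -> z \in `]l, h[.
Proof.
rewrite !in_itv/= => /andP[lx _] /andP[_ yh] /andP[xz zy].
by rewrite (lt_le_trans lx) ?(le_lt_trans zy).
Qed.

Lemma continuous_neq0_sign (l h : R) (f : R -> R) :
  {in `]l, h[, continuous f} -> {in `]l, h[, forall x, f x != 0} ->
  {in `]l, h[ &, forall x y, 0 < f x -> 0 < f y}.
Proof.
move=> cf f0.
have ivt x y : x \in `]l, h[ -> y \in `]l, h[ -> x <= y ->
    Num.min (f x) (f y) < 0 < Num.max (f x) (f y) -> False.
  move=> xlh ylh xy /andP[m0 M0].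
  have [||z zxy fz0] := @IVT R f x y 0 xy.
  - apply: continuous_in_subspaceT => z; rewrite inE/= in_itv/= => zxy.
    by apply: cf; exact: in_itvoo_trans zxy.
  - by rewrite !ltW.
  have zlh : z \in `]l, h[ by apply: in_itvoo_trans zxy.
  by have := f0 _ zlh; rewrite fz0 eqxx.
move=> x y xlh ylh fx; rewrite lt_neqAle eq_sym f0//= leNgt; apply/negP => fy.
have [xy|yx] := leP x y.
  by apply: (ivt x y) => //; rewrite gt_min lt_max fx fy orbT.
by apply: (ivt y x) => //; rewrite ?(ltW yx)// gt_min lt_max fx fy orbT.
Qed.

Lemma Rintegral_itv_gt0 (l h : R) (f : R -> R) : l < h ->
  mu.-integrable `]l, h[ (EFin \o f) -> {in `]l, h[, forall x, 0 < f x} ->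
  0 < \int[mu]_(x in `]l, h[) f x.
Proof.
move=> lh intf f0; have mf := measurable_int _ intf.
rewrite -lte_fin /Rintegral fineK; last exact: integrable_fin_num.
by apply: integral_itv_gt0 => //; exact/measurable_EFinP.
Qed.

(** With [f] continuous on the open interval only, extreme values need not exist. Instead, let [c]
    be the [q]-weighted mean of [f]: if [f - c] had no zero it would keep the sign it has at the
    midpoint, and [q * (f - c)] could not have integral 0. This also places [xi] in the interior. *)
Lemma weighted_mean_value (l h : R) (q f : R -> R) : l < h ->
  {in `]l, h[, forall x, 0 < q x} ->
  mu.-integrable `]l, h[ (EFin \o q) ->
  mu.-integrable `]l, h[ (fun x => (q x * f x)%:E) ->
  {in `]l, h[, continuous f} ->
  exists2 xi, xi \in `]l, h[ &
    \int[mu]_(x in `]l, h[) (q x * f x) = f xi * \int[mu]_(x in `]l, h[) q x.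
Proof.
move=> lh q0 iq iqf cf.
have Q0 := Rintegral_itv_gt0 lh iq q0.
set Q := \int[mu]_(x in `]l, h[) q x in Q0 *.
pose c := (\int[mu]_(x in `]l, h[) (q x * f x)) / Q.
have cE : \int[mu]_(x in `]l, h[) (q x * f x) = c * Q by rewrite divfK// gt_eqF.
apply: contrapT => nex.
have fc x : x \in `]l, h[ -> f x - c != 0.
  move=> xlh; apply/eqP => /subr0_eq fxc; apply: nex; exists x => //.
  by rewrite cE fxc.
have cg : {in `]l, h[, continuous (fun x => f x - c)}.
  by move=> x xlh; apply: cvgB; [exact: cf|exact: cvg_cst].
have icq : mu.-integrable `]l, h[ (EFin \o (fun x => c * q x)) by exact: (integrableZl _ c iq).
have iqc : mu.-integrable `]l, h[ (EFin \o (fun x => q x * (f x - c))).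
  rewrite (_ : _ \o _ = ((fun x => (q x * f x)%:E) \- (EFin \o (fun x => (c * q x)%R)))%E).
    exact: integrableB.
  by apply/funext => x /=; rewrite -EFinB; congr EFin; ring.
have I0 : \int[mu]_(x in `]l, h[) (q x * (f x - c)) = 0.
  transitivity (\int[mu]_(x in `]l, h[) (q x * f x - c * q x)).
    by apply: eq_Rintegral => x _; ring.
  by rewrite RintegralB// cE RintegralZl// subrr.
have mlh : (l + h) / 2 \in `]l, h[ by rewrite in_itv/=; lra.
have [gm|gm] := ltP 0 (f ((l + h) / 2) - c).
  have : 0 < \int[mu]_(x in `]l, h[) (q x * (f x - c)).
    apply: Rintegral_itv_gt0 => // x xlh; rewrite mulr_gt0 ?q0//.
    exact: (continuous_neq0_sign cg fc mlh xlh).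
  by rewrite I0 ltxx.
have : 0 < \int[mu]_(x in `]l, h[) (- 1 * (q x * (f x - c))).
  apply: Rintegral_itv_gt0 => //; first exact: (integrableZl _ (- 1) iqc).
  move=> x xlh; rewrite mulrCA mulr_gt0 ?q0// mulN1r opprB.
  have cg' : {in `]l, h[, continuous (fun x => c - f x)}.
    by move=> y ylh; apply: cvgB; [exact: cvg_cst|exact: cf].
  apply: (continuous_neq0_sign cg' _ mlh xlh).
    by move=> y ylh; rewrite -opprB oppr_eq0 fc.
  by rewrite -opprB oppr_gt0 lt_neqAle fc.
by rewrite RintegralZl// I0 mulr0 ltxx.
Qed.

End weighted_mean_value.

(** * Behaviour at [a], and the integral of order 1 *)

Section frac_int_order1.
Context {R : realType} (a b : R) (ab : a < b) (psi : R -> R).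
Hypothesis hk : kernel_function a b psi.
Notation p := (derive_oc a b psi).
Notation mu := (@lebesgue_measure R).
Notation bmf := (bounded_measurable a b).
Notation k := (frac_kernel a b psi).
Notation I := (frac_int a b psi).

Lemma bounded_measurable_within (w : R -> R) : {within `[a, b], continuous w} -> bmf w.
Proof.
move=> cw; have [cwo _ _] := (continuous_within_itvP w ab).1 cw.
split; first by apply: open_continuous_measurable_fun => // x; rewrite inE/=; exact: cwo.
have cn : {within `[a, b], continuous (fun x => `|w x|)}.
  by move=> x; apply: continuous_comp; [exact: cw|exact: norm_continuous].
have [c cab cM] := EVT_max (ltW ab) cn.
by exists `|w c| => s sab; apply: cM; exact: subset_itv_oo_cc.
Qed.

Lemma frac_int_cvg_a (g : R) (w : R -> R) : bmf w -> 0 < g ->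
  I g w c @[c --> a^'+] --> 0.
Proof.
move=> bw g0; have [M wM] := bw.2.
have G1 : 0 < Gamma (g + 1) by apply: Gamma_gt0; rewrite addr_gt0.
have acc : a \in `[a, b] by rewrite in_itv/= lexx ltW.
have near_ab : \forall c \near a^'+, c \in `]a, b[.
  near=> c; rewrite in_itv/=; apply/andP; split.
    by near: c; exact: nbhs_right_gt.
  by near: c; exact: nbhs_right_lt.
have psicvg : psi c - psi a @[c --> a^'+] --> 0^'+.
  apply: cvg_within_filter.
    by rewrite -(subrr (psi a)); apply: cvgB; [exact: kernel_at_a hk|exact: cvg_cst].
  near=> c; have cab : c \in `]a, b[ by near: c.
  have ccc : c \in `[a, b] by exact: subset_itv_oo_cc.
  have ac : a < c by move: cab; rewrite in_itv/= => /andP[].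
  by rewrite /= subr_gt0; exact: (kernel_lt ab hk acc ccc ac).
have bnd : M * ((psi c - psi a) `^ g / Gamma (g + 1)) @[c --> a^'+] --> 0.
  rewrite -(mulr0 M); apply: cvgMr; rewrite -(mul0r (Gamma (g + 1))^-1); apply: cvgMl.
  exact: (cvg_comp _ _ psicvg (powR_cvg0 g0)).
apply/norm_cvg0P; apply: (squeeze_cvgr _ (cvg_cst 0) bnd).
near=> c; have cab : c \in `]a, b[ by near: c.
rewrite normr_ge0/= (frac_intE ab hk)//; last exact: subset_itv_oo_oc.
move: cab; rewrite in_itv/= => /andP[ac cb].
by apply: (le_abs_frac_int ab hk) => //; exact: ltW.
Unshelve. all: by end_near. Qed.

Lemma frac_kernel1 (t s : R) : k 1 t s = p s.
Proof. by rewrite /frac_kernel subrr powRr0 Gamma1 divr1 mulr1. Qed.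

(** At order 1 the kernel does not depend on the upper endpoint, so the integral is additive over
    adjacent intervals; other orders lack this. *)
Lemma frac_int1B (c t : R) (w : R -> R) : bmf w -> a < c -> c < t -> t <= b ->
  I 1 w t - I 1 w c = \int[mu]_(s in `]c, t[) (p s * w s).
Proof.
move=> bw ac ct tb.
have at_ := lt_trans ac ct.
have cab : c \in `]a, b] by rewrite in_itv/= ac (le_trans (ltW ct)).
have tab : t \in `]a, b] by rewrite in_itv/= at_.
have iw := integrable_frac_kernelM ab hk bw ltr01 (lexx a) at_ tb.
have E d : d \in `]a, b] -> I 1 w d = \int[mu]_(s in `]a, d[) (p s * w s).
  move=> dab; rewrite (frac_intE ab hk bw ltr01 dab); apply: eq_Rintegral => s _.
  by rewrite frac_kernel1.
have iw' : mu.-integrable `]a, t[ (EFin \o (fun s => p s * w s)).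
  by apply: eq_integrable iw => // s _ /=; rewrite frac_kernel1.
by rewrite !E// (Rintegral_oo_split ac ct iw') addrC addKr.
Qed.

End frac_int_order1.

(** * Inversion of one derivative, and its iteration *)

Section caputo_taylor_formula.
Context {R : realType} (a b : R) (ab : a < b) (psi : R -> R).
Hypothesis hk : kernel_function a b psi.
Notation p := (derive_oc a b psi).
Notation mu := (@lebesgue_measure R).
Notation bmf := (bounded_measurable a b).
Notation I := (frac_int a b psi).

Lemma within_cc_oc (w : R -> R) t : {within `[a, b], continuous w} ->
  t \in `]a, b] -> w y @[y --> within `]a, b] (nbhs t)] --> w t.
Proof.
move=> cw tab.
have cw' : {within `]a, b], continuous w}.
  by apply: continuous_subspaceW cw; exact: subset_itv_oc_cc.
by move: cw' => /subspace_continuousP; apply.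
Qed.

(** The fundamental theorem on [[c, t]] makes [f - I 1 w] take the same value at every [c] in []a,
    t[] as at [t], and both terms tend to 0 as [c] tends to [a]. The limit at [a] is assumed instead
    of a value, since [f] is only controlled on []a, b]]. *)
Lemma rho_antiderivative (f w : R -> R) :
  {within `[a, b], continuous w} ->
  (forall t, t \in `]a, b] -> derivable_oc a b f t) ->
  {in `]a, b], rho a b psi f =1 w} ->
  f c @[c --> a^'+] --> 0 ->
  {in `]a, b], f =1 I 1 w}.
Proof.
move=> cw df fw fa t tab.
have bw := bounded_measurable_within ab cw.
have dfo x : x \in `]a, b[ -> is_derive x 1 f (p x * w x).
  move=> xab; have xoc : x \in `]a, b] by exact: subset_itv_oo_oc.
  rewrite -fw// /rho mulrA mulfV ?mul1r ?(kernel_derive_neq0 hk)//.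
  by apply: is_derive_derive_oc => //; exact: df.
have const c : a < c -> c < t -> f c - I 1 w c = f t - I 1 w t.
  move: (tab); rewrite in_itv/= => /andP[at_ tb] ac ct.
  have sub x : x \in `]c, t[ -> x \in `]a, b[.
    by rewrite !in_itv/= => /andP[/(lt_trans ac) -> /lt_le_trans ->].
  have cco : c \in `]a, b[ by rewrite in_itv/= ac (lt_le_trans ct).
  have cpw : {within `[c, t], continuous (fun x => p x * w x)}.
    have cp : {within `[c, t], continuous p}.
      apply: continuous_subspaceW (kernel_derive_continuous hk).
      by apply: subset_itv; rewrite bnd_simp.
    have cw' : {within `[c, t], continuous w}.
      by apply: continuous_subspaceW cw; apply: subset_itv; rewrite bnd_simp// ltW.
    by move=> x; apply: cvgM; [exact: cp|exact: cw'].
  have FTC : (\int[mu]_(x in `[c, t]) (p x * w x)%:E = (f t)%:E - (f c)%:E)%E.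
    apply: continuous_FTC2 => //.
      split.
      - by move=> x /sub /dfo [].
      - apply: cvg_at_right_filter; apply: differentiable_continuous.
        by apply/derivable1_diffP; have [] := dfo _ cco.
      (* The point [t] may be [b], where only the derivative relative to []a, b]] is at hand; it
         yields left continuity. *)
      - exact: within_oc_left tab (derivable_oc_continuous (df _ tab)).
    move=> x /sub /dfo dfx; by rewrite derive1E derive_val.
  have := frac_int1B ab hk bw ac ct tb.
  have ioo : mu.-integrable `]c, t[ (EFin \o (fun x => p x * w x)).
    apply: eq_integrable (integrable_frac_kernelM ab hk bw ltr01 (ltW ac) ct tb) => // s _ /=.
    by rewrite (frac_kernel1 a b psi).
  have mpw : measurable_fun `]c, t[ (fun x => (p x * w x)%:E) := measurable_int _ ioo.
  rewrite /Rintegral -(integral_itv_bndoo true false mpw) FTC /= => E.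
  by move: (I 1 w t) (I 1 w c) (f t) (f c) E => A B C D E; lra.
have lim0 : f c - I 1 w c @[c --> a^'+] --> 0.
  rewrite -(subrr 0); apply: cvgB => //; exact: (frac_int_cvg_a ab hk).
have lim1 : f c - I 1 w c @[c --> a^'+] --> f t - I 1 w t.
  apply: cvg_near_cst; near=> c; apply: const.
    by near: c; exact: nbhs_right_gt.
  by near: c; apply: nbhs_right_lt; move: tab; rewrite in_itv/= => /andP[].
by apply/eqP; rewrite -subr_eq0; apply/eqP; exact: cvg_unique lim1 lim0.
Unshelve. all: by end_near. Qed.

(* On each ]c, t[ the weighted mean value theorem yields a zero of [h]; these
   zeros accumulate at [t] from the left. *)
Lemma eq_of_frac_int1 (h : R -> R) : bmf h ->
  {in `]a, b], forall t, h y @[y --> within `]a, b] (nbhs t)] --> h t} ->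
  {in `]a, b], forall t, I 1 h t = 0} ->
  {in `]a, b], forall t, h t = 0}.
Proof.
move=> bh ch Ih t tab; apply/eqP/negP => /negP ht0.
move: (tab); rewrite in_itv/= => /andP[at_ tb].
have hleft := within_oc_left tab (ch _ tab).
have ne : \forall y \near t^'-, h y != 0 by exact: cvgr_neq0 hleft ht0.
have [d /= d0 dP] := ne.
(* This [c] lies in []a, t[] and within [d] of [t], so [h] has no zero on []c, t[]. *)
pose c := Num.max ((a + t) / 2) (t - d / 2).
have ac : a < c by rewrite lt_max; apply/orP; left; lra.
have ct : c < t by rewrite gt_max; apply/andP; split; lra.
have sub x : x \in `]c, t[ -> x \in `]a, b[.
  by rewrite !in_itv/= => /andP[/(lt_trans ac) -> /lt_le_trans ->].
have cab : c \in `]a, b] by rewrite in_itv/= ac (le_trans (ltW ct)).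
have iq : mu.-integrable `]c, t[ (EFin \o p).
  apply: eq_integrable (integrable_frac_kernel ab hk ltr01 (ltW ac) ct tb) => // s _ /=.
  by rewrite (frac_kernel1 a b psi).
have iqh : mu.-integrable `]c, t[ (fun s => (p s * h s)%:E).
  apply: eq_integrable (integrable_frac_kernelM ab hk bh ltr01 (ltW ac) ct tb) => // s _ /=.
  by rewrite (frac_kernel1 a b psi).
have p0 : {in `]c, t[, forall x, 0 < p x} by move=> x /sub /(kernel_derive_gt0 hk).
have cho : {in `]c, t[, continuous h}.
  move=> x /sub; apply: within_oc_continuous_oo.
  by apply/subspace_continuousP => y; exact: ch.
have [xi xict] := weighted_mean_value ct p0 iq iqh cho.
(* The integral of [p * h] over []c, t[] is a difference of two vanishing values of [I 1 h]; as [p]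
   has positive integral, [h xi = 0]. *)
rewrite -(frac_int1B ab hk bh ac ct tb) !Ih// subrr => /esym/eqP.
rewrite mulf_eq0 [X in _ || X]gt_eqF ?orbF; last exact: Rintegral_itv_gt0.
move: xict; rewrite in_itv/= gt_max => /andP[/andP[_ xid] xit].
apply/negP; apply: dP => //=; rewrite gtr0_norm ?subr_gt0//; lra.
Qed.

Lemma frac_intN (g t : R) (w : R -> R) : bmf w -> 0 < g -> t \in `]a, b] ->
  I g (fun s => - w s) t = - I g w t.
Proof.
move=> bw g0 tab; apply/eqP; rewrite -addr_eq0 -(frac_intD ab hk)//; last exact: bounded_measurableN.
rewrite (@frac_int_eq _ a b psi g t _ (fun=> 0))//; last by move=> s _ /=; rewrite addNr.
by rewrite (frac_int_cst ab hk)// !mul0r.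
Qed.

Lemma caputo_inversion (al : R) (v : R -> R) : 0 < al -> al <= 1 ->
  {within `[a, b], continuous v} -> caputo_exists a b psi al v ->
  {within `[a, b], continuous (caputo a b psi al v)} ->
  {in `]a, b], forall t, v t = v a + I al (caputo a b psi al v) t}.
Proof.
move=> al0 al1 cv dv cw.
set w := caputo a b psi al v in cw *.
pose v0 s := v s - v a.
have cv0 : {within `[a, b], continuous v0}.
  by move=> x; apply: cvgB; [exact: cv|exact: cvg_cst].
have bv0 := bounded_measurable_within ab cv0.
have bw := bounded_measurable_within ab cw.
(* On []a, b]] the test [t == a] in [caputo] fails, leaving the derivative itself. *)
have fw : {in `]a, b], rho a b psi (I (1 - al) v0) =1 w}.
  by move=> t; rewrite in_itv/= /w /caputo => /andP[at_ _]; rewrite gt_eqF.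
suff v0E : {in `]a, b], forall t, v0 t = I al w t}.
  by move=> t /v0E <-; rewrite /v0 addrC subrK.
(* For [al = 1] the inner integral has order 0, so [v0] itself is the antiderivative. *)
move: al1; rewrite le_eqVlt => /predU1P[alE|al1].
  rewrite alE; apply: rho_antiderivative => //.
  - by move=> t tab; have := dv t tab; rewrite alE subrr /frac_int eqxx.
  - by move=> t tab; have := fw t tab; rewrite alE subrr /frac_int eqxx.
  - have [_ va _] := (continuous_within_itvP v ab).1 cv.
    by rewrite -(subrr (v a)); apply: cvgB => //; exact: cvg_cst.
have al10 : 0 < 1 - al by rewrite subr_gt0.
have al11 : 1 - al <= 1 by rewrite gerBl ltW.
have fE : {in `]a, b], I (1 - al) v0 =1 I 1 w}.
  by apply: rho_antiderivative => //; exact: (frac_int_cvg_a ab hk).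
have bI := bounded_measurable_frac_int ab hk bw al0 (ltW al1).
have bh : bmf (fun s => v0 s + - I al w s) by apply: bounded_measurableD => //; exact: bounded_measurableN.
(* Both sides equal I^(al+1) w: on the left, I^1 v0 = I^al I^(1-al) v0 = I^al I^1 w. *)
have IE t : t \in `]a, b] -> I 1 v0 t = I 1 (I al w) t.
  move=> tab; move: (tab); rewrite in_itv/= => /andP[at_ tb].
  rewrite (frac_int_semigroup ab hk bw ltr01 al0 (ltW al1) tab).
  have := frac_int_semigroup ab hk bv0 al0 al10 al11 tab.
  rewrite (addrC al) subrK => <-.
  rewrite [1 + al]addrC -(frac_int_semigroup ab hk bw al0 ltr01 (lexx 1) tab).
  apply: (@frac_int_eq _ a b psi _ _ _ _ al0) => s sat; apply: fE.
  by move: sat; rewrite !in_itv/= => /andP[-> /ltW /le_trans ->].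
have h0 : {in `]a, b], forall t, v0 t + - I al w t = 0}.
  apply: eq_of_frac_int1 => //.
    move=> t tab; apply: cvgB; first exact: within_cc_oc.
    exact: (frac_int_continuous ab hk bw al0 (ltW al1)).
  move=> t tab; rewrite (frac_intD ab hk)//; last exact: bounded_measurableN.
  by rewrite frac_intN// IE// subrr.
by move=> t /h0 /eqP; rewrite subr_eq0 => /eqP.
Qed.

Lemma frac_int_mean_value (g t : R) (w : R -> R) : 0 < g -> t \in `]a, b] ->
  {within `[a, b], continuous w} ->
  exists2 xi, xi \in `]a, t[ &
    I g w t = w xi / Gamma (g + 1) * (psi t - psi a) `^ g.
Proof.
move=> g0 tab cw; have bw := bounded_measurable_within ab cw.
move: (tab); rewrite in_itv/= => /andP[at_ tb].
have cwo : {in `]a, t[, continuous w}.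
  move=> x; rewrite in_itv/= => /andP[ax xt].
  have [cwo _ _] := (continuous_within_itvP w ab).1 cw.
  by apply: cwo; rewrite in_itv/= ax (lt_le_trans xt).
have [xi xiat E] := weighted_mean_value at_
  (fun s => frac_kernel_gt0 ab hk g0 tab (s := s))
  (integrable_frac_kernel ab hk g0 (lexx a) at_ tb)
  (integrable_frac_kernelM ab hk bw g0 (lexx a) at_ tb) cwo.
exists xi => //; rewrite (frac_intE ab hk bw g0 tab) E.
rewrite (Rintegral_frac_kernel ab hk g0 (lexx a) at_ tb).
by rewrite mulrA mulrAC.
Qed.

(** Each step inverts the last derivative inside the remainder: its value at [a], a constant,
    integrates to the next monomial, and the semigroup law merges the rest into order
    [(n + 1) al]. *)
Lemma caputo_taylor (al : R) (n : nat) (u : R -> R) : 0 < al -> al <= 1 ->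
  caputo_seq_continuous a b psi al n u ->
  {in `]a, b], forall t, u t =
    \sum_(0 <= j < n) caputo_seq a b psi al j u a / Gamma (j%:R * al + 1)
       * (psi t - psi a) `^ (j%:R * al)
    + I (n%:R * al) (caputo_seq a b psi al n u) t}.
Proof.
move=> al0 al1; elim: n => [|n IH] [ex ct] t tab.
  by rewrite big_geq// add0r mul0r /frac_int eqxx.
have IHn : caputo_seq_continuous a b psi al n u.
  by split=> j jn; [apply: ex|apply: ct]; rewrite ltnW.
rewrite (IH IHn t tab) big_nat_recr; last by [].
rewrite -addrA; congr (_ + _).
set D := caputo_seq a b psi al n u; set D' := caputo_seq a b psi al n.+1 u.
have inv : {in `]a, b], forall s, D s = D a + I al D' s}.
  apply: caputo_inversion => //; [exact: ct|exact: ex|exact: (ct n.+1)].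
have bD' := bounded_measurable_within ab (ct n.+1 (leqnn _)).
(* For [n = 0] the outer operator is the identity, to which the semigroup law for positive orders
   does not apply; the new term is the constant [D a]. *)
have [->|n0] := posnP n.
  rewrite !mul0r mul1r {1}/frac_int eqxx add0r Gamma1 powRr0 divr1 mulr1.
  exact: inv.
have na0 : 0 < n%:R * al by rewrite mulr_gt0// ltr0n.
transitivity (I (n%:R * al) (fun s => D a + I al D' s) t).
  apply: (@frac_int_eq _ a b psi _ _ _ _ na0) => s sat; apply: inv.
  by move: sat tab; rewrite !in_itv/= => /andP[-> /ltW /le_trans h /andP[_ /h]].
have bI := bounded_measurable_frac_int ab hk bD' al0 al1.
rewrite (frac_intD ab hk (bounded_measurable_cst a b (D a)) bI na0 tab).
rewrite (frac_int_cst ab hk (D a) na0 tab).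
rewrite (frac_int_semigroup ab hk bD' na0 al0 al1 tab).
by rewrite -(natr1 n) mulrDl mul1r.
Qed.

End caputo_taylor_formula.

Theorem theorem4p5 (R : realType) (a b : R) (a_ge0 : 0 <= a) (a_lt_b : a < b)
    (psi : R -> R) (psi_kernel : kernel_function a b psi)
    (alpha : R) (alpha_gt0 : 0 < alpha) (alpha_le1 : alpha <= 1)
    (m : nat) (u : R -> R)
    (u_seq : caputo_seq_continuous a b psi alpha m.+1 u) :
  forall t : R, t \in `]a, b] ->
  exists2 xi : R, xi \in `]a, t[ &
    u t =
      \sum_(0 <= j < m.+1)
        caputo_seq a b psi alpha j u a / Gamma (j%:R * alpha + 1)
          * (psi t - psi a) `^ (j%:R * alpha)
      + caputo_seq a b psi alpha m.+1 u xi / Gamma (m.+1%:R * alpha + 1)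
          * (psi t - psi a) `^ (m.+1%:R * alpha).
Proof.
move=> t tab.
have ma0 : 0 < m.+1%:R * alpha by rewrite mulr_gt0.
have [xi xiat E] := frac_int_mean_value a_lt_b psi_kernel ma0 tab (u_seq.2 _ (leqnn _)).
exists xi => //.
by rewrite (caputo_taylor a_lt_b psi_kernel alpha_gt0 alpha_le1 u_seq tab) E.
Qed.
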